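(* Assume the setting below and suppose every coordinate of the saddle point is subcritical, i.e. $\zeta_j<1$ for every $j\in\mathcal{A}$. Then, as $n\to+\infty$, \[ \mathbb{P}(m \text{ is an } \boldsymbol{\alpha}\text{-winner}) \sim \frac{P(\boldsymbol{\zeta})^n}{\prod_{j\in\mathcal{A}}\big((1-\zeta_j)\,\zeta_j^{\lceil \beta_j n\rceil-1}\big)}\cdot\frac{1}{\sqrt{(2\pi n)^{m-1}\det(\mathcal{H}_K(\boldsymbol{\tau}))}}. \]
   Context: Fix an integer $m\ge 2$ of candidates $\{1,\dots,m\}$ and let $\mathcal{A}=\{1,\dots,m-1\}$ (the adversaries of candidate $m$). There are $n$ voters; each voter independently draws a strict ranking $r$ of the candidates with probability $p_r$, where $p_r>0$ for each of the $m!$ rankings and $\sum_r p_r=1$ (these probabilities do not depend on $n$). For $\mathcal{X}\subseteq\mathcal{A}$, let $p_{\mathcal{X}}$ be the probability that, in a random ranking, the set of adversaries ranked above $m$ is exactly $\mathcal{X}$. The characteristic polynomial is $P(\mathbf{x})=\sum_{\mathcal{X}\subseteq\mathcal{A}} p_{\mathcal{X}}\prod_{j\in\mathcal{X}}x_j$ in $\mathbf{x}=(x_1,\dots,x_{m-1})$. Fix $\boldsymbol{\alpha}\in(0,1)^{m-1}$ and set $\boldsymbol{\beta}=\mathbf{1}-\boldsymbol{\alpha}$. Candidate $m$ is an $\boldsymbol{\alpha}$-winner if for every $j\in\mathcal{A}$, strictly more than $\alpha_j n$ voters rank $m$ above $j$. Let $K(\mathbf{t})=\log P(e^{t_1},\dots,e^{t_{m-1}})$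 for $\mathbf{t}\in\mathbb{R}^{m-1}$ (cumulant generating function); the function $\mathbf{t}\mapsto -K(\mathbf{t})+\boldsymbol{\beta}^T\mathbf{t}$ has a unique maximizer $\boldsymbol{\tau}\in\mathbb{R}^{m-1}$ (the log saddle point), and $\boldsymbol{\zeta}=(e^{\tau_1},\dots,e^{\tau_{m-1}})$ is the saddle point. $\mathcal{H}_K(\boldsymbol{\tau})$ denotes the Hessian matrix of $K$ at $\boldsymbol{\tau}$. *)

(* Defs.v *)
From HB Require Import structures.
From mathcomp Require Import all_boot all_order all_algebra all_fingroup.
From mathcomp Require Import all_classical all_reals all_analysis.
Set Implicit Arguments. Unset Strict Implicit. Unset Printing Implicit Defensive.
Import Order.TTheory GRing.Theory Num.Theory.
Local Open Scope ring_scope.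

(* Candidates {1,...,m} are encoded as 'I_m with m = k.+1; candidate m is
   ord_max, adversary j (1 <= j <= m-1) is the ordinal j-1 : 'I_k, embedded
   in 'I_k.+1 by widen_ord.  A strict ranking is a permutation r : 'S_m,
   r c being the position of candidate c (position 0 = top). *)
Section Defs.
Variable R : realType.
Variable k : nat.

Definition cand_m : 'I_k.+1 := ord_max.
Definition adv (j : 'I_k) : 'I_k.+1 := widen_ord (leqnSn k) j.

Definition above (r : 'S_k.+1) (a b : 'I_k.+1) : bool := (r a < r b)%N.

Definition adv_above (r : 'S_k.+1) : {set 'I_k} := [set j | above r (adv j) cand_m].

Definition pX (p : 'S_k.+1 -> R) (X : {set 'I_k}) : R :=
  \sum_(r | adv_above r == X) p r.

Definition charpoly (p : 'S_k.+1 -> R) (x : 'I_k -> R) : R :=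
  \sum_(X : {set 'I_k}) pX p X * \prod_(j in X) x j.

Definition cgf (p : 'S_k.+1 -> R) (t : 'I_k -> R) : R :=
  ln (charpoly p (fun j => expR (t j))).

Definition hessian (f : ('I_k -> R) -> R) (t : 'I_k -> R) : 'M[R]_k :=
  \matrix_(i, j) derive1 (fun s : R =>
      derive1 (fun u : R =>
         f (fun l => t l + s * (i == l)%:R + u * (j == l)%:R)) 0) 0.

Definition alpha_winner (n : nat) (alpha : 'I_k -> R)
    (prof : {ffun 'I_n -> 'S_k.+1}) : bool :=
  [forall j : 'I_k,
     alpha j * n%:R < (#|[set i : 'I_n | above (prof i) cand_m (adv j)]|)%:R].

Definition prob_winner (p : 'S_k.+1 -> R) (alpha : 'I_k -> R) (n : nat) : R :=
  \sum_(prof : {ffun 'I_n -> 'S_k.+1})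
     (\prod_(i : 'I_n) p (prof i)) * (alpha_winner alpha prof)%:R.

End Defs.

(* Main.v *)
(* Tilting each vote by the saddle point (q_r proportional to p_r times the
   product of zeta_j over the adversaries j ranked above m) turns the number of
   voters preferring each adversary into a sum of i.i.d. vectors with mean beta
   and covariance H_K(tau). With b_j = ceil(beta_j n), the probability of a win is

     P(zeta)^n / prod_j zeta_j^(b_j - 1)
       * sum_(nu <= b - 1) prod_j zeta_j^(b_j - 1 - nu_j) Q_n(nu),

   Q_n being the law of the tilted counts. Since zeta_j < 1 the geometric weights
   concentrate on nu = n beta + O(1), where the local limit theorem gives
   Q_n(nu) ~ ((2 pi n)^(m-1) det H_K(tau))^(-1/2); the weights then sum to
   prod_j 1 / (1 - zeta_j).

   The local limit theorem needs no multiple integral: the counts lie in [0, n],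
   so discrete Fourier inversion over the (2n+1)-th roots of unity is exact, and
   comparing the characteristic function with a Gaussian leaves the lattice sum
   of exp(- x^T H x / 2) over a grid of mesh 2 pi sqrt n / (2n+1). That sum is
   evaluated by completing the square in one coordinate at a time, which peels
   off one pivot of det H (Schur complement) and one Riemann sum of the Gauss
   integral. *)
Require Import Defs.
From HB Require Import structures.
From mathcomp Require Import all_boot all_order all_algebra all_fingroup.
From mathcomp Require Import all_classical all_reals all_analysis.
From mathcomp Require Import complex ring lra.
Import Order.TTheory GRing.Theory Num.Theory.
Import numFieldNormedType.Exports.
Set Implicit Arguments.
Unset Strict Implicit.
Unset Printing Implicit Defensive.
Local Open Scope ring_scope.
Local Open Scope classical_set_scope.

(** * One-dimensional Gaussian Riemann sums *)

Section RealCalculus.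
Context {R : realType}.
Implicit Types (f df : R -> R) (a b x y : R).

Lemma MVT_derive f df a b : (forall x, a <= x <= b -> is_derive x 1 f (df x)) ->
  a <= b -> exists2 c, a <= c <= b & f b - f a = df c * (b - a).
Proof.
move=> fd ab.
have [x||c cab ->] := @MVT_segment R f df a b ab.
- by rewrite in_itv /= => /andP[ax xb]; apply: fd; rewrite !ltW.
- apply: derivable_within_continuous => x xab.
  by have [] := fd x; rewrite in_itv in xab.
- by exists c => //; rewrite in_itv in cab.
Qed.

Lemma le_derive f df a b : (forall x, a <= x <= b -> is_derive x 1 f (df x)) ->
  a <= b -> (forall x, a <= x <= b -> 0 <= df x) -> f a <= f b.
Proof.
move=> fd ab df0; rewrite -subr_ge0.
have [c cab ->] := MVT_derive fd ab.
by rewrite mulr_ge0 ?subr_ge0// df0.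
Qed.

Lemma is_derive_comp_opp f (d x : R) : is_derive (- x) 1 f d ->
  is_derive x 1 (fun y => f (- y)) (- d).
Proof.
move=> fd; rewrite -mulrN1; exact: is_derive1_comp.
Qed.

End RealCalculus.

(** * An odd primitive of the Gaussian, with its limit and tail *)

Section GaussPrimitive.
Context {R : realType}.
Implicit Types (x y z : R) (M N : nat).
Local Notation mu := (@lebesgue_measure R).

(** Half-line integrals let the fundamental theorem of calculus apply at every real point, whatever
    its sign; subtracting the value at 0 makes the primitive odd. *)
Definition gauss_primitive x : R :=
  (\int[mu]_(t in `]-oo, x]) gauss_fun t - \int[mu]_(t in `]-oo, 0]) gauss_fun t)%R.
Local Notation Psi := gauss_primitive.

Lemma gauss_primitive0 : Psi 0 = 0.
Proof. exact: subrr. Qed.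

Lemma is_derive_gauss_primitive x : is_derive x 1 Psi (gauss_fun x).
Proof.
have Hi : mu.-integrable `]-oo, x + 1] (EFin \o @gauss_fun R).
  by apply: (integrableS _ _ _ integrableT_gauss).
have [d e] := continuous_FTC1 (ltr_pwDr ltr01 (lexx x)) Hi (ltNyr _)
  (@continuous_gauss_fun R x).
rewrite -[gauss_fun x]subr0; apply: is_deriveB.
by apply: DeriveDef => //; rewrite -e derive1E.
Qed.

(** The function [Psi y + Psi (- y)] has zero derivative, the Gaussian being even, and it vanishes
    at 0. *)
Lemma gauss_primitiveN x : Psi (- x) = - Psi x.
Proof.
have H y : is_derive y 1 (fun y => Psi y + Psi (- y)) 0.
  have d1 := is_derive_gauss_primitive y.
  have d2 := is_derive_comp_opp (is_derive_gauss_primitive (- y)).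
  by apply: is_derive_eq; rewrite /gauss_fun sqrrN subrr.
wlog x0 : x / 0 <= x => [hw|].
  have [/hw//|/ltW x0] := leP 0 x.
  by have := hw (- x); rewrite oppr_ge0 opprK => /(_ x0) ->; rewrite opprK.
have [c _] := MVT_derive (fun y _ => H y) x0.
rewrite oppr0 gauss_primitive0 mul0r addr0 subr0 => /eqP.
by rewrite addrC addr_eq0 => /eqP.
Qed.

Lemma le_gauss_primitive x y : x <= y -> Psi x <= Psi y.
Proof.
move=> xy; apply: (le_derive (fun z _ => is_derive_gauss_primitive z)) => // z _.
exact: gauss_fun_ge0.
Qed.

Lemma gauss_primitive_ge0E x : 0 <= x ->
  Psi x = gauss_integral_proof.integral0_gauss x.
Proof.
move=> x0; rewrite /Psi Rintegral_itvB//=; last first.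
  by apply: (integrableS _ _ _ integrableT_gauss).
rewrite Rintegral_itv_obnd_cbnd//.
by apply: (integrableS _ _ _ integrableT_gauss).
Qed.

Lemma cvg_gauss_primitive : Psi x @[x --> +oo] --> Num.sqrt pi / 2.
Proof.
have E : Num.sqrt (pi / 4) = Num.sqrt pi / 2 :> R.
  rewrite sqrtrM ?pi_ge0// sqrtrV// (_ : 4 = 2 ^+ 2); last by rewrite expr2 -natrM.
  by rewrite sqrtr_sqr ger0_norm.
rewrite -E.
apply: (@cvg_trans _ ((fun x => Num.sqrt
   (gauss_integral_proof.integral0_gauss x ^+ 2)) @ +oo)); last first.
  apply: continuous_cvg; first exact: sqrt_continuous.
  exact: gauss_integral_proof.cvg_integral0_gauss_sqr.
apply: near_eq_cvg; near=> x.
rewrite sqrtr_sqr ger0_norm ?gauss_integral_proof.integral0_gauss_ge0//.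
by rewrite gauss_primitive_ge0E.
Unshelve. all: end_near. Qed.

Lemma gauss_primitive_le x : Psi x <= Num.sqrt pi / 2.
Proof.
apply: (@cvgr_to_ge _ _ _ _ Psi _ _ cvg_gauss_primitive); near=> y.
by apply: le_gauss_primitive.
Unshelve. all: end_near. Qed.

(** Since [exp (- z^2) <= z^-2], the function [Psi t + t^-1] is nonincreasing on the positive axis,
    so it stays above its limit [sqrt pi / 2]. *)
Lemma gauss_primitive_tail x : 0 < x -> Num.sqrt pi / 2 - x^-1 <= Psi x.
Proof.
move=> x0; rewrite lerBlDr.
apply: (@cvgr_to_le _ _ _ _ Psi _ _ cvg_gauss_primitive); near=> y.
have xy : x <= y by [].
have H z : x <= z <= y ->
    is_derive z 1 (fun t => - (Psi t + t^-1)) (z ^- 2 - gauss_fun z).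
  move=> /andP[xz _]; have z0 : z != 0 by rewrite gt_eqF// (lt_le_trans x0).
  have d1 := is_derive_gauss_primitive z.
  have d2 : is_derive z 1 (fun t : R => t^-1) (- z ^- 2).
    apply: DeriveDef; first exact: derivableV.
    by rewrite deriveV// derive_id scaler1.
  by apply: is_derive_eq; ring.
have := le_derive H xy; rewrite lerN2 => H'.
have {}H' := H' _.
rewrite (le_trans _ (H' _))//.
  by rewrite lerDl invr_ge0 (le_trans (ltW x0)).
move=> z /andP[xz _]; rewrite subr_ge0 /gauss_fun expRN.
have z0 : 0 < z by rewrite (lt_le_trans x0).
rewrite lef_pV2 ?posrE ?expR_gt0 ?exprn_gt0//.
by rewrite (le_trans _ (expR_ge1Dx _))// lerDr.
Unshelve. all: end_near. Qed.

End GaussPrimitive.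

(** * Riemann sums of the Gaussian with explicit errors *)

Section GaussRiemannSum.
Context {R : realType}.
Implicit Types (x y z h : R) (M N : nat).
Local Notation g := (@gauss_fun R).
Local Notation Psi := gauss_primitive.

Lemma le_gauss x y : `|x| <= `|y| -> g y <= g x.
Proof.
move=> xy; rewrite /gauss_fun ler_expR lerN2 -[leLHS]real_normK ?num_real//.
by rewrite -[leRHS]real_normK ?num_real// lerXn2r ?nnegrE.
Qed.

(* [V y - V x] is the total variation of [gauss_fun] on [[x, y]]. *)
Let V x : R := if x <= 0 then g x else 2 - g x.

Let V_ge0 x : 0 <= V x.
Proof.
rewrite /V; case: ifP => _; first exact: gauss_fun_ge0.
by have := gauss_fun_le1 x; lra.
Qed.

Let V_le2 x : V x <= 2.
Proof.
rewrite /V; have := gauss_fun_ge0 x; have := gauss_fun_le1 x.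
by case: ifP => _; lra.
Qed.

Let gauss_variation x y : x <= y -> `|g x - g y| <= V y - V x.
Proof.
move=> xy; rewrite /V ler_norml.
have := gauss_fun_ge0 x; have := gauss_fun_le1 x.
have := gauss_fun_ge0 y; have := gauss_fun_le1 y.
have [y0|y0] := leP y 0.
  rewrite (le_trans xy y0).
  have : g x <= g y by apply: le_gauss; rewrite !ler0_norm ?(le_trans xy y0)// lerN2.
  by lra.
have [x0|x0] := leP x 0; first by lra.
have : g y <= g x by apply: le_gauss; rewrite !gtr0_norm.
by lra.
Qed.

Let gauss_step x h : 0 <= h ->
  `|h * g x - (Psi (x + h) - Psi x)| <= h * (V (x + h) - V x).
Proof.
move=> h0; have xh : x <= x + h by rewrite lerDl.
have [c /andP[xc ch] ->] := MVT_derive (fun z _ => is_derive_gauss_primitive z) xh.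
rewrite (addrC x h) addrK mulrC -mulrBl normrM (ger0_norm h0) mulrC ler_wpM2l//.
apply: (le_trans (gauss_variation xc)); rewrite lerD2r -subr_ge0.
rewrite addrC in ch.
by rewrite (le_trans _ (gauss_variation ch)).
Qed.

(** On each cell the mean value theorem writes the integral as [h * g c], and the error is charged
    to the increment of [V]. These increments telescope, and [V] takes values in [0, 2], so the
    bound is uniform in [x] and [N]. *)
Lemma gauss_riemann_sum x h N : 0 <= h ->
  `|\sum_(i < N) h * g (x + h * i%:R) - (Psi (x + h * N%:R) - Psi x)| <= h * 2.
Proof.
move=> h0.
suff H : `|\sum_(i < N) h * g (x + h * i%:R) - (Psi (x + h * N%:R) - Psi x)| <=
    h * (V (x + h * N%:R) - V x).
  apply: (le_trans H); rewrite ler_wpM2l// lerBlDr.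
  by apply: (le_trans (V_le2 _)); rewrite lerDl.
elim: N => [|N ih]; first by rewrite big_ord0 mulr0 addr0 !subrr normr0 mulr0.
rewrite big_ord_recr/= -natr1 mulrDr mulr1 addrA.
have := gauss_step (x + h * N%:R) h0.
set y := x + h * N%:R in ih *; set S := \sum_(i < N) _ in ih *.
rewrite -(lerD2r (h * (V y - V x))) => H.
apply: (le_trans _ (le_trans H _)); last by rewrite -mulrDr subrKA.
rewrite (le_trans _ (lerD (lexx _) ih))//.
have -> : S + h * g y - (Psi (y + h) - Psi x) =
  h * g y - (Psi (y + h) - Psi y) + (S - (Psi y - Psi x)) by ring.
exact: ler_normD.
Qed.

Lemma gauss_sum_le x h N : 0 <= h ->
  \sum_(i < N) h * g (x + h * i%:R) <= Num.sqrt pi + h * 2.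
Proof.
move=> h0; have := gauss_riemann_sum x N h0; rewrite ler_norml => /andP[_].
have := gauss_primitive_le (x + h * N%:R).
have := gauss_primitive_le (- x); rewrite gauss_primitiveN.
by lra.
Qed.

(** If [2 * |z| <= y], the tail bound applies at [y - |z| >= y / 2]. Otherwise the subtracted term
    is at least 2, hence at least [sqrt pi], and the trivial bound [- sqrt pi / 2 <= Psi]
    suffices. *)
Let gauss_tail_shift y z : 0 < y ->
  Num.sqrt pi / 2 - 4 * (1 + `|z|) / y <= Psi (y - `|z|).
Proof.
move=> y0; have z0 := normr_ge0 z.
have [zy|zy] := leP (2 * `|z|) y.
  have u0 : 0 < y - `|z| by lra.
  apply: le_trans (gauss_primitive_tail u0); rewrite lerD2l lerN2.
  rewrite -[leLHS]mul1r ler_pdivrMr// mulrAC ler_pdivlMr//.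
  by nra.
have h1 := gauss_primitive_le (- (y - `|z|)); rewrite gauss_primitiveN in h1.
have h2 : Num.sqrt pi <= 2 :> R.
  rewrite -(@ger0_norm R 2)// -sqrtr_sqr ler_wsqrtr//.
  by have := @pihalf_lt2 R; lra.
suff : 2 <= 4 * (1 + `|z|) / y by lra.
by rewrite ler_pdivlMr//; lra.
Qed.

(* The truncation error is kept linear in the shift [z], so that it can be
   summed against a Gaussian weight in the remaining coordinates. *)
Lemma gauss_sum_shift z h M : 0 < h -> (0 < M)%N ->
  `|\sum_(i < M.*2.+1) h * g (h * (i%:R - M%:R) + z) - Num.sqrt pi| <=
  2 * h + 8 * (1 + `|z|) / (h * M%:R).
Proof.
move=> h0 M0; have y0 : 0 < h * M%:R by rewrite mulr_gt0 ?ltr0n.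
have E : \sum_(i < M.*2.+1) h * g (h * (i%:R - M%:R) + z) =
    \sum_(i < M.*2.+1) h * g ((z - h * M%:R) + h * i%:R).
  by apply: eq_bigr => i _; congr (_ * g _); ring.
rewrite E.
have := gauss_riemann_sum (z - h * M%:R) M.*2.+1 (ltW h0).
move: (\sum_(i < _) _) => S.
have -> : z - h * M%:R + h * M.*2.+1%:R = h * M%:R + h + z.
  by rewrite -natr1 -mul2n natrM; ring.
have h1 := gauss_tail_shift z y0.
have zN : - z <= `|z| by rewrite -normrN ler_norm.
have h2 : Psi (h * M%:R - `|z|) <= Psi (h * M%:R + h + z).
  by apply: le_gauss_primitive; lra.
have h3 : Psi (h * M%:R - `|z|) <= - Psi (z - h * M%:R).
  by rewrite -gauss_primitiveN opprB; apply: le_gauss_primitive; have := ler_norm z; lra.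
have h4 := gauss_primitive_le (h * M%:R + h + z).
have h5 := gauss_primitive_le (- (z - h * M%:R)); rewrite gauss_primitiveN in h5.
have -> : 8 * (1 + `|z|) / (h * M%:R) = 2 * (4 * (1 + `|z|) / (h * M%:R)) by ring.
move: (4 * _ / _) h1 => E4 h1.
rewrite !ler_norml => /andP[h6 h7]; apply/andP; split; lra.
Qed.

End GaussRiemannSum.

(** * Trigonometric estimates *)

Section Trigo.
Context {R : realType}.
Implicit Types (t x : R).

Lemma sin_le_id x : 0 <= x -> sin x <= x.
Proof.
move=> x0; rewrite -subr_ge0.
have -> : 0 = 0 - sin 0 :> R by rewrite sin0 subrr.
apply: (@le_derive _ (fun y => y - sin y) (fun y => 1 - cos y)) => //.
Qed.

(** In this chain of Taylor bounds, the gap of each inequality has the gap of the preceding one as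
    its derivative, and both sides agree at 0. *)
Lemma cos_ge_quad x : 1 - x ^+ 2 / 2 <= cos x.
Proof.
wlog x0 : x / 0 <= x => [hw|].
  have [/hw//|/ltW x0] := leP 0 x.
  by rewrite -cosN -sqrrN hw ?oppr_ge0.
rewrite -subr_ge0.
have -> : 0 = cos 0 - (1 - 0 ^+ 2 / 2) :> R by rewrite cos0 expr0n/=; ring.
apply: (@le_derive _ (fun y => cos y - (1 - y ^+ 2 / 2)) (fun y => y - sin y)) => //.
  by move=> y _; apply: is_derive_eq; rewrite /GRing.scale/=; field.
by move=> y /andP[y0 _]; rewrite subr_ge0 sin_le_id.
Qed.

Lemma sin_ge_cubic x : 0 <= x -> x - x ^+ 3 / 6 <= sin x.
Proof.
move=> x0; rewrite -subr_ge0.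
have -> : 0 = sin 0 - (0 - 0 ^+ 3 / 6) :> R by rewrite sin0 expr0n/=; ring.
apply: (@le_derive _ (fun y => sin y - (y - y ^+ 3 / 6))
  (fun y => cos y - (1 - y ^+ 2 / 2))) => //.
  by move=> y _; apply: is_derive_eq; rewrite /GRing.scale/=; field.
by move=> y _; rewrite subr_ge0 cos_ge_quad.
Qed.

Lemma cos_le_quartic x : cos x <= 1 - x ^+ 2 / 2 + x ^+ 4 / 24.
Proof.
wlog x0 : x / 0 <= x => [hw|].
  have [/hw//|/ltW x0] := leP 0 x.
  have := hw (- x); rewrite oppr_ge0 => /(_ x0).
  by rewrite cosN sqrrN (_ : (- x) ^+ 4 = x ^+ 4); [|ring].
rewrite -subr_ge0.
have -> : 0 = 1 - 0 ^+ 2 / 2 + 0 ^+ 4 / 24 - cos 0 :> R.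
  by rewrite cos0 !expr0n/=; ring.
apply: (@le_derive _ (fun y => 1 - y ^+ 2 / 2 + y ^+ 4 / 24 - cos y)
  (fun y => sin y - (y - y ^+ 3 / 6))) => //.
  by move=> y _; apply: is_derive_eq; rewrite /GRing.scale/=; field.
by move=> y /andP[y0 _]; rewrite subr_ge0 sin_ge_cubic.
Qed.

(** Write [1 - cos t = 2 * sin (t / 2) ^+ 2]; the cubic bound gives [sin (t / 2) >= t / 6] as long
    as [t ^+ 2 <= 16], which [pi < 4] ensures. The estimate covers a full period and controls the
    characteristic function far from 0 as well as near it. *)
Lemma cos_lt_quad t : `|t| <= pi -> t ^+ 2 / 18 <= 1 - cos t.
Proof.
wlog t0 : t / 0 <= t => [hw|].
  have [/hw//|/ltW t0] := leP 0 t.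
  by rewrite -normrN -cosN -sqrrN => /hw; apply; rewrite oppr_ge0.
rewrite ger0_norm// => tpi.
have -> : 1 - cos t = 2 * sin (t / 2) ^+ 2.
  have {1}-> : t = (t / 2) *+ 2 by rewrite mulr2n; field.
  by rewrite cos_mulr2n cos2sin2; ring.
have h1 := sin_ge_cubic (divr_ge0 t0 (ler0n R 2)).
have := @pihalf_lt2 R => h2.
have t4 : t ^+ 2 <= 16 by nra.
have h3 : t / 6 <= sin (t / 2).
  apply: le_trans h1; rewrite -subr_ge0.
  have -> : t / 2 - (t / 2) ^+ 3 / 6 - t / 6 = t * (16 - t ^+ 2) / 48 by field.
  by rewrite divr_ge0// mulr_ge0// subr_ge0.
have h4 : 0 <= t / 6 by rewrite divr_ge0.
nra.
Qed.

End Trigo.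

(** * Complex modulus and points of the unit circle *)

Section Cis.
Context {R : realType}.
Implicit Types (t s : R) (z w : R[i]).
Local Notation normc := (@Normc.normc R).

Lemma normc_ge0 z : 0 <= normc z.
Proof. by case: z => a b /=; rewrite sqrtr_ge0. Qed.

Lemma normcD_le z w : normc (z + w) <= normc z + normc w.
Proof. exact: (@le_normcD R). Qed.

Lemma normc_sum_le (I : Type) (r : seq I) (P : pred I) (F : I -> R[i]) :
  normc (\sum_(i <- r | P i) F i) <= \sum_(i <- r | P i) normc (F i).
Proof.
elim/big_rec2: _ => [|i x y _ h]; first by rewrite (@Normc.normc0 R).
by rewrite (le_trans (normcD_le _ _))// lerD2l.
Qed.

Lemma normcX z n : normc (z ^+ n) = normc z ^+ n.
Proof.
elim: n => [|n ih]; first by rewrite !expr0 (@Normc.normc1 R).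
by rewrite !exprS Normc.normcM ih.
Qed.

Lemma normc_real (x : R) : normc (x%:C)%C = `|x|.
Proof. by rewrite /= expr0n/= addr0 sqrtr_sqr. Qed.

Lemma normc_le_add (a b : R) : normc (a +i* b)%C <= `|a| + `|b|.
Proof.
rewrite /= -[leRHS]ger0_norm ?addr_ge0// -sqrtr_sqr ler_wsqrtr//.
rewrite sqrrD !real_normK ?num_real// lerD2r lerDl.
by rewrite mulrn_wge0// mulr_ge0.
Qed.

(** The difference of powers is [z - w] times a sum of [n.+1] products of [n] factors. This converts
    an error on the characteristic function of one vote into an error for all votes. *)
Lemma normc_exprB_le z w (m : R) n : normc z <= m -> normc w <= m ->
  normc (z ^+ n.+1 - w ^+ n.+1) <= n.+1%:R * m ^+ n * normc (z - w).
Proof.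
move=> zm wm; have m0 : 0 <= m := le_trans (normc_ge0 z) zm.
rewrite subrXX Normc.normcM mulrC ler_wpM2r ?normc_ge0//.
apply: le_trans (normc_sum_le _ _ _) _.
have -> : n.+1%:R * m ^+ n = \sum_(i < n.+1) m ^+ n.
  by rewrite sumr_const card_ord mulr_natl.
apply: ler_sum => i _.
rewrite Normc.normcM !normcX.
have -> : m ^+ n = m ^+ (n - i) * m ^+ i by rewrite -exprD subnK// -ltnS.
by rewrite ler_pM ?exprn_ge0 ?normc_ge0// lerXn2r ?nnegrE ?normc_ge0.
Qed.

Definition cis t : R[i] := (cos t +i* sin t)%C.

Lemma cis0 : cis 0 = 1.
Proof. by rewrite /cis cos0 sin0. Qed.

Lemma cisD s t : cis (s + t) = cis s * cis t.
Proof. by rewrite /cis cosD sinD; congr Complex; rewrite addrC. Qed.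

Lemma cis_sum (I : Type) (r : seq I) (P : pred I) (F : I -> R) :
  cis (\sum_(i <- r | P i) F i) = \prod_(i <- r | P i) cis (F i).
Proof. exact: (big_morph cis cisD cis0). Qed.

Lemma cis_mulrn t n : cis (t *+ n) = cis t ^+ n.
Proof.
elim: n => [|n ih]; first by rewrite mulr0n expr0 cis0.
by rewrite mulrS cisD ih exprS.
Qed.

Lemma normc_cis t : normc (cis t) = 1.
Proof. by rewrite /= cos2Dsin2 sqrtr1. Qed.

Lemma cis2pi : cis (pi *+ 2) = 1.
Proof. by rewrite /cis cos2pi sin2pi. Qed.

Lemma normc_cisB1_le t : normc (cis t - 1) <= `|t|.
Proof.
rewrite /= -(sqrtr_sqr t) ler_wsqrtr// oppr0 addr0.
have := cos2Dsin2 t; have := cos_ge_quad t; nra.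
Qed.

Lemma normc_cis_taylor t :
  normc (cis t - ((1 - t ^+ 2 / 2) +i* t)%C) <= `|t| ^+ 3.
Proof.
apply: (le_trans (normc_le_add _ _)).
have hs : `|sin t - t| <= `|t| ^+ 3 / 6.
  wlog t0 : t / 0 <= t => [hw|].
    have [/hw//|/ltW t0] := leP 0 t.
    by have := hw (- t); rewrite oppr_ge0 => /(_ t0); rewrite sinN -opprD !normrN.
  rewrite ler0_norm ?subr_le0 ?sin_le_id// opprB (ger0_norm t0).
  by rewrite lerBlDl -lerBlDr sin_ge_cubic.
have hc : `|cos t - (1 - t ^+ 2 / 2)| <= `|t| ^+ 3 / 2.
  rewrite ger0_norm ?subr_ge0 ?cos_ge_quad//.
  have h1 := cos_le_quartic t; have h2 := cos_le1 t.
  rewrite -[t ^+ 2]real_normK ?num_real//.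
  have e4 : t ^+ 4 = `|t| ^+ 4 by rewrite -normrX ger0_norm// exprn_even_ge0.
  rewrite e4 -[t ^+ 2]real_normK ?num_real// in h1.
  have := normr_ge0 t; move: `|t| h1 => u h1 u0.
  (* Up to 1 the quartic term is below the cubic one; beyond 1, [cos t <= 1] alone leaves
     [u ^+ 2 / 2 <= u ^+ 3 / 2]. *)
  have [u1|/ltW u1] := leP u 1.
    have : u ^+ 4 <= u ^+ 3 by rewrite ler_wiXn2l.
    have : 0 <= u ^+ 3 by rewrite exprn_ge0.
    lra.
  have : u ^+ 2 <= u ^+ 3 by rewrite ler_weXn2l.
  lra.
have := exprn_ge0 3 (normr_ge0 t); lra.
Qed.

End Cis.

(** * Gaussian sums over a k-dimensional grid *)

Section FinFunCons.

Definition ffcons (T : Type) k (t : T) (l : {ffun 'I_k -> T}) : {ffun 'I_k.+1 -> T} :=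
  [ffun i => oapp l t (unlift ord0 i)].

Lemma ffcons0 (T : Type) k (t : T) (l : {ffun 'I_k -> T}) : ffcons t l ord0 = t.
Proof. by rewrite ffunE unlift_none. Qed.

Lemma ffconsS (T : Type) k (t : T) (l : {ffun 'I_k -> T}) i :
  ffcons t l (lift ord0 i) = l i.
Proof. by rewrite ffunE liftK. Qed.

Lemma big_ffun_cons (R : nmodType) (T : finType) k
    (F : {ffun 'I_k.+1 -> T} -> R) :
  \sum_l F l = \sum_(l : {ffun 'I_k -> T}) \sum_t F (ffcons t l).
Proof.
rewrite pair_big/= (reindex (fun u => ffcons u.2 u.1)); first by [].
exists (fun l : {ffun 'I_k.+1 -> T} => ([ffun i => l (lift ord0 i)], l ord0)).
- move=> [l t] _ /=; rewrite ffcons0; congr pair.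
  by apply/ffunP => i; rewrite ffunE ffconsS.
- move=> l _ /=; apply/ffunP => i; rewrite ffunE.
  by case: unliftP => [j ->|->] //=; rewrite ffunE.
Qed.

End FinFunCons.

(** * Quadratic forms, Schur complements and determinants *)

Section QuadraticForm.
Context {R : realType}.
Implicit Types k : nat.

Definition qform k (A : 'M[R]_k) (x : 'I_k -> R) : R :=
  \sum_i \sum_j A i j * x i * x j.

(** Positive definiteness with an explicit constant: the same [lambda] passes to Schur complements
    and gives the rate of the Gaussian weight that dominates the errors. *)
Definition coercive k (A : 'M[R]_k) (lambda : R) : Prop :=
  forall x : 'I_k -> R, lambda * \sum_i x i ^+ 2 <= qform A x.

Definition schur k (A : 'M[R]_k.+1) : 'M[R]_k :=
  \matrix_(i, j) (A (lift ord0 i) (lift ord0 j) -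
    A (lift ord0 i) ord0 * A ord0 (lift ord0 j) / A ord0 ord0).

(** Block LU factorization with a unipotent lower factor. *)
Lemma det_schur k (A : 'M[R]_k.+1) : A ord0 ord0 != 0 ->
  \det A = A ord0 ord0 * \det (schur A).
Proof.
move=> a0; pose B : 'M[R]_(1 + k) := A.
pose a := A ord0 ord0.
have uE : ulsubmx B = a%:M.
  by apply/matrixP => i j; rewrite !ord1 !mxE !lshift0 eqxx.
have BE : B = block_mx 1%:M 0 (a^-1 *: dlsubmx B) 1%:M *m
    block_mx (a%:M) (ursubmx B) 0 (schur A).
  rewrite mulmx_block !mul1mx !mul0mx !addr0.
  rewrite -{1}[B]submxK uE; congr block_mx.
  - by rewrite -scalemxAl mul_mx_scalar scalerA mulVf// scale1r.
  - apply/matrixP => i j; rewrite !mxE big_ord1 !mxE !rshift1 !lshift0 /B -/a.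
    by field.
have -> : \det A = \det B by [].
rewrite BE det_mulmx (@det_lblock _ 1 k) (@det_ublock _ 1 k) !det1 !mul1r det_scalar1.
by [].
Qed.

Lemma qform_schur k (A : 'M[R]_k.+1) (x : 'I_k.+1 -> R) :
  (forall i j, A i j = A j i) -> A ord0 ord0 != 0 ->
  let y j := x (lift ord0 j) in
  qform A x = A ord0 ord0 *
      (x ord0 + \sum_j A ord0 (lift ord0 j) / A ord0 ord0 * y j) ^+ 2 +
    qform (schur A) y.
Proof.
move=> Asym a0 y; set a := A ord0 ord0 in a0 *.
set b := fun j => A ord0 (lift ord0 j).
have -> : qform (schur A) y = \sum_i \sum_j A (lift ord0 i) (lift ord0 j) * y i * y j
    - (\sum_j b j * y j) ^+ 2 / a.
  rewrite expr2 mulr_suml mulr_suml -sumrB; apply: eq_bigr => i _.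
  rewrite mulr_sumr mulr_suml -sumrB; apply: eq_bigr => j _.
  by rewrite mxE -/a [A (lift ord0 i) ord0]Asym /b; field.
have -> : \sum_j A ord0 (lift ord0 j) / a * y j = (\sum_j b j * y j) / a.
  by rewrite mulr_suml; apply: eq_bigr => j _; rewrite /b; field.
rewrite /qform big_ord_recl big_ord_recl/= -/a.
under [X in _ + X = _]eq_bigr do rewrite big_ord_recl.
rewrite big_split/=.
have -> : \sum_(i < k) A ord0 (lift ord0 i) * x ord0 * x (lift ord0 i) =
    x ord0 * \sum_j b j * y j.
  by rewrite mulr_sumr; apply: eq_bigr => j _; rewrite /b /y; ring.
have -> : \sum_(i < k) A (lift ord0 i) ord0 * x (lift ord0 i) * x ord0 =
    x ord0 * \sum_j b j * y j.
  rewrite mulr_sumr; apply: eq_bigr => j _.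
  by rewrite [A (lift ord0 j) ord0]Asym /b /y; ring.
by move: (\sum_j b j * y j) (\sum_i _) => u v; field.
Qed.

Lemma schur_sym k (A : 'M[R]_k.+1) : (forall i j, A i j = A j i) ->
  forall i j, schur A i j = schur A j i.
Proof.
move=> Asym i j; rewrite !mxE Asym (Asym (lift ord0 i) ord0).
by rewrite (Asym ord0 (lift ord0 j)); ring.
Qed.

Lemma coercive_diag_gt0 k (A : 'M[R]_k.+1) lambda : 0 < lambda ->
  coercive A lambda -> 0 < A ord0 ord0.
Proof.
move=> l0 /(_ (fun i => (i == ord0)%:R)); rewrite /qform.
rewrite big_ord_recl/= big1 => [|i _]; last by rewrite expr0n.
rewrite big_ord_recl/= [X in _ <= _ + X]big1 => [|i _]; last first.
  by rewrite big1// => j _; rewrite mulr0 mul0r.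
rewrite big_ord_recl/= big1 => [|i _]; last by rewrite mulr0.
by rewrite expr1n !addr0 !mulr1; apply: lt_le_trans.
Qed.

(** Extend [x] by the coordinate [- c] that annihilates the completed square: [qform A] then equals
    [qform (schur A)], while the sum of squares can only grow. *)
Lemma schur_coercive k (A : 'M[R]_k.+1) lambda : 0 < lambda ->
  (forall i j, A i j = A j i) -> coercive A lambda -> coercive (schur A) lambda.
Proof.
move=> l0 Asym cA x.
have a0 := coercive_diag_gt0 l0 cA.
pose c := \sum_j A ord0 (lift ord0 j) / A ord0 ord0 * x j.
pose z i := oapp x (- c) (unlift ord0 i).
have zS j : z (lift ord0 j) = x j by rewrite /z liftK.
have z0 : z ord0 = - c by rewrite /z unlift_none.
have := cA z; rewrite qform_schur ?gt_eqF//.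
rewrite (_ : (fun j => z (lift ord0 j)) = x); last exact/funext.
rewrite (eq_bigr (fun j => A ord0 (lift ord0 j) / A ord0 ord0 * x j)); last first.
  by move=> j _; rewrite zS.
rewrite -/c z0 addNr expr0n/= mulr0 add0r; apply: le_trans.
rewrite ler_pM2l// big_ord_recl.
by under [X in _ <= _ + X]eq_bigr do rewrite zS; rewrite lerDr sqr_ge0.
Qed.

Lemma coercive_det_gt0 k (A : 'M[R]_k) lambda : 0 < lambda ->
  (forall i j, A i j = A j i) -> coercive A lambda -> 0 < \det A.
Proof.
move=> l0; elim: k => [|k ih] in A *; first by move=> _ _; rewrite det_mx00.
move=> Asym cA; have a0 := coercive_diag_gt0 l0 cA.
rewrite det_schur ?gt_eqF// mulr_gt0// ih//; first exact: schur_sym.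
exact: schur_coercive.
Qed.

End QuadraticForm.

(** * Gaussian sums over cubic grids *)

Section LatticeGaussSum.
Context {R : realType}.
Implicit Types (k M : nat) (h : R).

Definition grid M h (i : 'I_M.*2.+1) : R := h * (i%:R - M%:R).

(** With [d = c / 3], it suffices to take the cube of [1 + |t| <= (1 + d^-1) * (1 + d * t^2) <= (1 +
    d^-1) * exp (d * t^2)]. *)
Lemma cube_expR_bound (c : R) : 0 < c ->
  exists2 C, 0 < C & forall t : R, (1 + `|t|) ^+ 3 <= C * expR (c * t ^+ 2).
Proof.
move=> c0; pose d := c / 3; have d0 : 0 < d by rewrite divr_gt0.
have D0 : 0 < d^-1 by rewrite invr_gt0.
exists ((1 + d^-1) ^+ 3); first by rewrite exprn_gt0// addr_gt0.
move=> t; have -> : c * t ^+ 2 = 3%:R * (d * t ^+ 2) by rewrite /d; field.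
rewrite expRM_natl -exprMn lerXn2r ?nnegrE ?addr_ge0 ?mulr_ge0 ?expR_ge0//.
  by rewrite addr_ge0// ltW.
rewrite (@le_trans _ _ ((1 + d^-1) * (1 + d * t ^+ 2)))//; last first.
  by rewrite ler_pM2l ?addr_gt0// expR_ge1Dx.
rewrite -[t ^+ 2]real_normK ?num_real//; move: `|t| (normr_ge0 t) => u u0.
have : 0 <= d * (u - d^-1) ^+ 2 by rewrite mulr_ge0 ?sqr_ge0 ?ltW.
have -> : d * (u - d^-1) ^+ 2 = d * u ^+ 2 - 2 * u + d^-1.
  by field; rewrite gt_eqF.
have -> : (1 + d^-1) * (1 + d * u ^+ 2) = 1 + d^-1 + d * u ^+ 2 + u ^+ 2.
  by field; rewrite gt_eqF.
have := sqr_ge0 u; lra.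
Qed.

Lemma one_add_sum_le_prod (I : finType) (x : I -> R) : (forall i, 0 <= x i) ->
  1 + \sum_i x i <= \prod_i (1 + x i).
Proof.
move=> x0.
suff : 0 <= \sum_i x i /\ 1 + \sum_i x i <= \prod_i (1 + x i) by case.
elim/big_rec2: _ => [|i y s _ [s0 ih]]; first by rewrite addr0.
have := x0 i => xi0; split; first by rewrite addr_ge0.
nra.
Qed.

Lemma prodr_ge1 (I : finType) (P : pred I) (x : I -> R) :
  (forall i, 1 <= x i) -> 1 <= \prod_(i | P i) x i.
Proof.
move=> x1; elim/big_ind: _ => // a b a1 b1.
by rewrite -[1]mulr1 ler_pM.
Qed.

(** The cubic weight is below a product of one-coordinate weights, each absorbed by half of the
    Gaussian exponent. The other half gives a sum that factors into [k] one-dimensional Gaussian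
    sums, bounded uniformly in [h] and [M]. *)
Lemma lattice_moment_bound k (c H : R) : 0 < c -> 0 <= H ->
  exists2 C, 0 < C & forall h M, 0 < h <= H ->
    h ^+ k * \sum_(l : {ffun 'I_k -> 'I_M.*2.+1})
      ((1 + \sum_j `|grid h (l j)|) ^+ 3 * expR (- (c * \sum_j grid h (l j) ^+ 2)))
    <= C.
Proof.
move=> c0 H0; have c20 : 0 < c / 2 by rewrite divr_gt0.
have [K K0 HK] := cube_expR_bound c20.
pose s := Num.sqrt (c / 2); have s0 : 0 < s by rewrite sqrtr_gt0.
have s2 : s ^+ 2 = c / 2 by rewrite sqr_sqrtr// ltW.
pose B := K * ((Num.sqrt pi + (s * H) * 2) / s).
have B0 : 0 < B.
  rewrite mulr_gt0// divr_gt0//.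
  by rewrite ltr_pwDl ?sqrtr_gt0 ?pi_gt0// !mulr_ge0// ltW.
exists (B ^+ k); first exact: exprn_gt0.
move=> h M /andP[h0 hH].
pose F (i : 'I_M.*2.+1) := h * (K * gauss_fun (s * grid h i)).
have FB : \sum_i F i <= B.
  rewrite /F (eq_bigr (fun i : 'I_M.*2.+1 =>
     K / s * ((s * h) * gauss_fun (- (s * h * M%:R) + (s * h) * i%:R)))).
    have -> : B = K / s * (Num.sqrt pi + s * H * 2) by rewrite /B; ring.
    rewrite -mulr_sumr ler_wpM2l//; first by rewrite divr_ge0// ltW.
    apply: le_trans (gauss_sum_le _ _ _) _; first by rewrite mulr_ge0// ltW.
    by rewrite lerD2l ler_pM2r// ler_pM2l.
  move=> i _; rewrite /grid.
  have -> : s * (h * (i%:R - M%:R)) = - (s * h * M%:R) + (s * h) * i%:R by ring.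
  by field; rewrite gt_eqF.
apply: (@le_trans _ _ (\sum_(l : {ffun 'I_k -> 'I_M.*2.+1}) \prod_j F (l j))).
  rewrite mulr_sumr; apply: ler_sum => l _.
  rewrite /F big_split/= prodr_const card_ord ler_pM2l ?exprn_gt0//.
  have -> : expR (- (c * \sum_j grid h (l j) ^+ 2)) =
     \prod_j expR (- (c / 2 * grid h (l j) ^+ 2)) *
     \prod_j gauss_fun (s * grid h (l j)).
    rewrite -!expR_sum -expRD; congr expR.
    under [X in _ + X]eq_bigr do rewrite exprMn s2 -mulrN.
    rewrite -mulr_sumr; under [X in X + _]eq_bigr do rewrite -mulrN.
    by rewrite -mulr_sumr sumrN; field.
  rewrite mulrA [leRHS]big_split/= ler_wpM2r//.
    by apply: prodr_ge0 => j _; exact: gauss_fun_ge0.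
  have -> : \prod_(i < k) K = \prod_j (K * expR (c / 2 * grid h (l j) ^+ 2)) *
     \prod_j expR (- (c / 2 * grid h (l j) ^+ 2)).
    rewrite -big_split/=; apply: eq_bigr => j _.
    by rewrite -[RHS]mulrA expRxMexpNx_1 mulr1.
  rewrite ler_wpM2r//; first by apply: prodr_ge0 => j _; exact: expR_ge0.
  rewrite (@le_trans _ _ ((\prod_j (1 + `|grid h (l j)|)) ^+ 3))//.
    rewrite lerXn2r ?nnegrE ?addr_ge0 ?sumr_ge0//.
      by apply: prodr_ge0 => j _; rewrite addr_ge0.
    exact: one_add_sum_le_prod.
  rewrite -prodrXl; apply: ler_prod => j _.
  by rewrite exprn_ge0 ?addr_ge0//= HK.
rewrite -(bigA_distr_bigA (fun _ i => F i))/= prodr_const card_ord.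
rewrite lerXn2r ?nnegrE ?(ltW B0)//.
by apply: sumr_ge0 => i _; rewrite !mulr_ge0 ?gauss_fun_ge0// ltW.
Qed.

Definition gauss_lattice_sum k (A : 'M[R]_k) h M : R :=
  h ^+ k * \sum_(l : {ffun 'I_k -> 'I_M.*2.+1})
    expR (- (qform A (fun j => grid h (l j)) / 2)).

(** After completing the square, the sum over coordinate 0 is a one-dimensional Gaussian sum shifted
    by a linear form [c l] in the others. It is close to [sqrt pi / s], with an error growing
    linearly in the shift, which the Gaussian weight of the Schur complement makes summable. *)
Lemma gauss_lattice_sum_schur k (A : 'M[R]_k.+1) lambda H : 0 < lambda -> 0 <= H ->
  (forall i j, A i j = A j i) -> coercive A lambda ->
  exists2 C, 0 < C & forall h M, 0 < h <= H -> (0 < M)%N ->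
    `|gauss_lattice_sum A h M -
      Num.sqrt (2 * pi) / Num.sqrt (A ord0 ord0) * gauss_lattice_sum (schur A) h M|
    <= C * (h + (h * M%:R)^-1).
Proof.
move=> l0 H0 Asym cA; have a0 := coercive_diag_gt0 l0 cA.
set a := A ord0 ord0 in a0 *.
pose s := Num.sqrt (a / 2); have s0 : 0 < s by rewrite sqrtr_gt0 divr_gt0.
have s2 : s ^+ 2 = a / 2 by rewrite sqr_sqrtr// divr_ge0// ltW.
have -> : Num.sqrt (2 * pi) / Num.sqrt a = Num.sqrt pi / s :> R.
  rewrite /s sqrtrM// sqrtrM ?(ltW a0)// sqrtrV// invfM invrK.
  by ring.
have cS := schur_coercive l0 Asym cA.
have [C C0 HC] := @lattice_moment_bound k (lambda / 2) H
  (divr_gt0 l0 (ltr0Sn _ _)) H0.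
pose b j := A ord0 (lift ord0 j) / a.
pose K := \sum_j `|b j|; have K0 : 0 <= K by exact: sumr_ge0.
(* Divided by [s], the error of [gauss_sum_shift] at mesh [s * h] is [2 * h + 8 * (1 + s * |c l|) /
   (s^2 * h * M)], and [|c l|] is at most [K] times the l1 norm of [x l]. *)
pose D := 2 + 8 * (1 + s * K) / s ^+ 2.
have D0 : 0 < D.
  by rewrite ltr_wpDr// divr_ge0 ?sqr_ge0// mulr_ge0// addr_ge0// mulr_ge0// ltW.
exists (D * C); first exact: mulr_gt0.
move=> h M /andP[h0 hH] M0.
have hM0 : 0 < h * M%:R by rewrite mulr_gt0// ltr0n.
pose x (l : {ffun 'I_k -> 'I_M.*2.+1}) j := grid h (l j).
pose c l := \sum_j b j * x l j.
pose G l := expR (- (qform (schur A) (x l) / 2)).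
pose I l := \sum_(t < M.*2.+1) h * gauss_fun (s * (grid h t + c l)).
have -> : gauss_lattice_sum A h M = h ^+ k * \sum_l G l * I l.
  rewrite /gauss_lattice_sum big_ffun_cons exprSr -mulrA; congr (_ * _).
  rewrite mulr_sumr; apply: eq_bigr => l _.
  rewrite /I mulr_sumr mulr_sumr; apply: eq_bigr => t _.
  rewrite mulrCA; congr (_ * _); rewrite -expRD; congr expR.
  rewrite qform_schur ?gt_eqF// ffcons0 -/a.
  rewrite (_ : (fun j => grid h (ffcons t l (lift ord0 j))) = x l); last first.
    by apply/funext => j; rewrite ffconsS.
  rewrite (eq_bigr (fun j => b j * x l j)); last by move=> j _; rewrite ffconsS.
  by rewrite -/(c l) exprMn s2; field.
have -> : gauss_lattice_sum (schur A) h M = h ^+ k * \sum_l G l by [].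
rewrite mulrCA -mulrBr mulr_sumr -sumrB normrM ger0_norm ?exprn_ge0 ?(ltW h0)//.
have IE l : `|I l - Num.sqrt pi / s| <=
    D * (h + (h * M%:R)^-1) * (1 + \sum_j `|x l j|) ^+ 3.
  have := gauss_sum_shift (s * c l) (mulr_gt0 s0 h0) M0.
  have -> : \sum_(i < M.*2.+1) s * h * gauss_fun (s * h * (i%:R - M%:R) + s * c l)
      = s * I l.
    rewrite /I [RHS]mulr_sumr; apply: eq_bigr => i _; rewrite mulrA; congr (_ * gauss_fun _).
    by rewrite /grid; ring.
  move=> H1.
  have -> : I l - Num.sqrt pi / s = (s * I l - Num.sqrt pi) / s.
    by field; rewrite gt_eqF.
  rewrite normrM normfV (gtr0_norm s0) ler_pdivrMr//; apply: (le_trans H1).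
  set X := \sum_j _; have X0 : 0 <= X by exact: sumr_ge0.
  have X1 : 1 <= (1 + X) ^+ 3 by rewrite exprn_ege1// lerDl.
  have cX : `|c l| <= K * X.
    apply: le_trans (ler_norm_sum _ _ _) _; rewrite /K mulr_suml.
    apply: ler_sum => j _; rewrite normrM ler_wpM2l//.
    by rewrite /X (bigD1 j)//= lerDl sumr_ge0.
  (* Linear growth is weakened to the cubic weight treated by [lattice_moment_bound]. *)
  have sc : 1 + `|s * c l| <= (1 + s * K) * (1 + X) ^+ 3.
    have X3 : 1 + X <= (1 + X) ^+ 3 by rewrite -[leLHS]expr1 ler_weXn2l// lerDl.
    rewrite (@le_trans _ _ ((1 + s * K) * (1 + X)))//; last first.
      by rewrite ler_wpM2l// addr_ge0// mulr_ge0// ltW.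
    rewrite normrM (gtr0_norm s0).
    have : s * `|c l| <= s * (K * X) by rewrite ler_pM2l.
    have : 0 <= s * K by rewrite mulr_ge0// ltW.
    nra.
  move: ((1 + X) ^+ 3) X1 sc => Y Y1 sc.
  have -> : D * (h + (h * M%:R)^-1) * Y * s = 2 * (s * h) * Y +
     8 * ((1 + s * K) * Y) / (s * h * M%:R) +
     (2 * s * (h * M%:R)^-1 * Y + 8 * (1 + s * K) / s * h * Y).
    by rewrite /D; field; rewrite !gt_eqF//= ltr0n.
  rewrite -[leLHS]addr0 lerD//; first rewrite lerD//.
  - by rewrite ler_peMr// !mulr_ge0// ltW.
  - by rewrite ler_wpM2r ?ler_pM2l// invr_ge0 -mulrA mulr_ge0// ltW.
  - have Y0 : 0 <= Y by apply: le_trans Y1.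
    rewrite addr_ge0// !mulr_ge0 ?invr_ge0 ?addr_ge0 ?mulr_ge0//; exact: ltW.
rewrite (@le_trans _ _ (D * (h + (h * M%:R)^-1) * (h ^+ k * \sum_l
    ((1 + \sum_j `|x l j|) ^+ 3 * expR (- (lambda / 2 * \sum_j x l j ^+ 2))))))//.
  rewrite mulrCA ler_pM2l ?exprn_gt0// mulr_sumr.
  apply: le_trans (ler_norm_sum _ _ _) _; apply: ler_sum => l _.
  have -> : G l * I l - Num.sqrt pi / s * G l = (I l - Num.sqrt pi / s) * G l by ring.
  rewrite normrM (ger0_norm (expR_ge0 _)) mulrA ler_pM ?expR_ge0//.
  rewrite ler_expR lerN2 mulrAC ler_pM2r ?invr_gt0//; exact: cS.
rewrite (mulrAC D C) ler_wpM2l//.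
  by apply: mulr_ge0; [exact: ltW|rewrite addr_ge0 ?invr_ge0// ltW].
by apply: HC; rewrite h0.
Qed.

(** Induction on the dimension: each pivot [a] contributes a factor [sqrt (2 * pi / a)], and the
    pivots multiply to [\det A]. The mesh must tend to 0 while the half-width [h n * M n] of the box
    tends to infinity. *)
Theorem gauss_lattice_sum_cvg k (A : 'M[R]_k) lambda H (h : nat -> R) (M : nat -> nat) :
  0 < lambda -> (forall i j, A i j = A j i) -> coercive A lambda ->
  (forall n, 0 < h n <= H) -> (forall n, 0 < M n)%N ->
  h n @[n --> \oo] --> 0 -> (h n * (M n)%:R)^-1 @[n --> \oo] --> 0 ->
  gauss_lattice_sum A (h n) (M n) @[n --> \oo] -->
    Num.sqrt ((2 * pi) ^+ k) / Num.sqrt (\det A).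
Proof.
move=> l0 Asym cA hH M0 hcvg hMcvg.
have H0 : 0 <= H by have /andP[h0 hle] := hH 0%N; rewrite (le_trans (ltW h0)).
elim: k => [|k ih] in A Asym cA *.
  rewrite expr0 det_mx00 sqrtr1 divr1.
  apply: cvg_near_cst; apply: nearW => n.
  rewrite /gauss_lattice_sum expr0 mul1r.
  rewrite (eq_bigr (fun=> 1)) => [|l _].
    by rewrite sumr_const card_ffun !card_ord expn0 mulr1n.
  by rewrite /qform big_ord0 mul0r oppr0 expR0.
have a0 := coercive_diag_gt0 l0 cA.
have [C C0 HC] := gauss_lattice_sum_schur l0 H0 Asym cA.
have {}ih := ih (schur A) (schur_sym Asym) (schur_coercive l0 Asym cA).
set a := A ord0 ord0 in a0 HC.
set r := Num.sqrt (2 * pi) / Num.sqrt a in HC.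
have -> : Num.sqrt ((2 * pi) ^+ k.+1) / Num.sqrt (\det A) =
    0 + r * (Num.sqrt ((2 * pi) ^+ k) / Num.sqrt (\det (schur A))).
  rewrite add0r det_schur ?gt_eqF// -/a exprS.
  rewrite sqrtrM ?mulr_ge0 ?pi_ge0// (sqrtrM _ (ltW a0)) invfM /r.
  by rewrite mulrACA.
rewrite (_ : (fun n => _) = (fun n => gauss_lattice_sum A (h n) (M n) -
   r * gauss_lattice_sum (schur A) (h n) (M n)) \+
   (fun n => r * gauss_lattice_sum (schur A) (h n) (M n))); last first.
  by apply/funext => n /=; rewrite subrK.
apply: cvgD; last by apply: cvgMl_tmp.
apply: norm_cvg0.
apply: (@squeeze_cvgr _ _ _ _ (cst 0) (fun n => C * (h n + (h n * (M n)%:R)^-1))).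
- by apply: nearW => n /=; rewrite normr_ge0 HC.
- exact: cvg_cst.
- rewrite -[X in _ --> X](mulr0 C); apply: cvgMl_tmp.
  by rewrite -[X in _ --> X](addr0 0); exact: cvgD.
Qed.

End LatticeGaussSum.

(** * Local limit theorem *)

Section CisOrthogonality.
Context {R : realType}.

(** Orthogonality of characters: for [a != b] this is, up to a phase, a full geometric sum of powers
    of an [N]-th root of unity other than 1. *)
Lemma cis_grid_sum n a b : (a <= n)%N -> (b <= n)%N ->
  \sum_(i < n.*2.+1) @cis R (grid (2 * pi / n.*2.+1%:R) i * (a%:R - b%:R)) =
  (n.*2.+1 * (a == b))%:R.
Proof.
move=> an bn; set N := n.*2.+1; have [->|ab] := eqVneq a b.
  rewrite muln1 (eq_bigr (fun=> 1)) ?sumr_const ?card_ord// => i _.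
  by rewrite subrr mulr0 cis0.
rewrite muln0; set t : R := 2 * pi / N%:R * (a%:R - b%:R).
have N0 : N%:R != 0 :> R by rewrite pnatr_eq0.
have cis2pin m : cis (2 * pi * m%:R : R) = 1.
  by rewrite mulr_natr mulr_natl cis_mulrn cis2pi expr1n.
have tN : cis t ^+ N = 1.
  have : cis (t *+ N) * cis (2 * pi * b%:R) = cis (2 * pi * a%:R).
    by rewrite -cisD; congr cis; rewrite /t -mulr_natr; field.
  by rewrite !cis2pin mulr1 cis_mulrn.
have t1 : cis t != 1.
  apply/eqP => -[ct _].
  (* Both [a] and [b] are at most [n] and [N = 2n + 1], so the angle lies in a range where
     [cos t = 1] forces [t = 0]. *)
  have tpi : `|t| <= pi.
    rewrite /t normrM ger0_norm ?divr_ge0 ?mulr_ge0 ?pi_ge0//.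
    have : `|a%:R - b%:R| <= n%:R :> R.
      have := ler0n R a; have := ler0n R b.
      move: an bn; rewrite -!(ler_nat R) ler_norml => an bn a0 b0.
      by apply/andP; split; lra.
    have NE : N%:R = 2 * n%:R + 1 :> R by rewrite /N -natr1 -mul2n natrM.
    move=> abn; rewrite mulrAC ler_pdivrMr ?ltr0n// NE.
    have := @pi_gt0 R; have := normr_ge0 (a%:R - b%:R : R); nra.
  have := cos_lt_quad tpi; rewrite ct subrr => t2.
  have /eqP : t ^+ 2 = 0 by apply/eqP; rewrite eq_le sqr_ge0 andbT; lra.
  rewrite expf_eq0/= /t !mulf_eq0 invr_eq0 (negbTE N0).
  by rewrite (gt_eqF (@pi_gt0 R)) pnatr_eq0/= subr_eq0 eqr_nat (negbTE ab).
have S0 : \sum_(i < N) cis t ^+ i = 0.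
  apply/eqP; have := subrX1 (cis t) N; rewrite tN subrr => /esym/eqP.
  by rewrite mulf_eq0 subr_eq0 (negbTE t1).
rewrite (eq_bigr (fun i : 'I_N => cis (- (n%:R * t)) * cis t ^+ i)) => [|i _].
  by rewrite -mulr_sumr S0 mulr0.
rewrite -cis_mulrn -cisD; congr cis.
by rewrite /grid /t -[_ *+ i]mulr_natr; ring.
Qed.

End CisOrthogonality.

(** * Counts of i.i.d. 0-1 vectors and their characteristic function *)

Section LocalLimit.
Context {R : realType} (T : finType) (k : nat) (q : T -> R) (Y : T -> 'I_k -> bool).
Hypotheses (q0 : forall t, 0 < q t) (q1 : \sum_t q t = 1).

Definition tcount n (w : {ffun 'I_n -> T}) (j : 'I_k) : nat :=
  (\sum_(i < n) Y (w i) j)%N.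

Definition count_law n (nu : 'I_k -> nat) : R :=
  \sum_(w : {ffun 'I_n -> T}) (\prod_i q (w i)) * [forall j, tcount w j == nu j]%:R.

Definition mean (j : 'I_k) : R := \sum_t q t * (Y t j)%:R.

Definition covmx : 'M[R]_k :=
  \matrix_(i, j) (\sum_t q t * ((Y t i)%:R * (Y t j)%:R) - mean i * mean j).

Let dev (x : 'I_k -> R) t : R := \sum_j x j * ((Y t j)%:R - mean j).

(* The characteristic function of the centred vector [Y - mean]. *)
Let phi (x : 'I_k -> R) : R[i] := \sum_t (q t)%:C%C * cis (dev x t).

(** Expand [phi ^+ n] over all samples [w] and sum over the grid first: orthogonality in each
    coordinate keeps exactly the samples whose count vector is [nu]. *)
Lemma count_law_inversion n (nu : 'I_k -> nat) : (forall j, nu j <= n)%N ->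
  (count_law n nu)%:C%C = (n.*2.+1%:R^-1 ^+ k) *
   \sum_(l : {ffun 'I_k -> 'I_n.*2.+1})
     (let theta j := grid (2 * pi / n.*2.+1%:R) (l j) in
      phi theta ^+ n * cis (- \sum_j theta j * ((nu j)%:R - n%:R * mean j))).
Proof.
move=> nun; set N := n.*2.+1.
pose th (l : {ffun 'I_k -> 'I_N}) j : R := grid (2 * pi / N%:R) (l j).
have E l : phi (th l) ^+ n * cis (- \sum_j th l j * ((nu j)%:R - n%:R * mean j)) =
    \sum_(w : {ffun 'I_n -> T}) (\prod_i q (w i))%:C%C *
      \prod_j cis (th l j * ((tcount w j)%:R - (nu j)%:R)).
  rewrite -[n in _ ^+ n]card_ord -prodr_const /phi bigA_distr_bigA mulr_suml.
  apply: eq_bigr => w _; rewrite big_split/= -rmorph_prod -mulrA; congr (_ * _).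
  rewrite -!cis_sum -cisD; congr cis.
  rewrite /dev exchange_big/= -sumrB; apply: eq_bigr => j _.
  rewrite -mulr_sumr -mulrBr; congr (_ * _).
  rewrite sumrB sumr_const card_ord -mulr_natl.
  have -> : \sum_(i < n) (Y (w i) j)%:R = (tcount w j)%:R :> R.
    by rewrite /tcount natr_sum.
  by ring.
rewrite (eq_bigr _ (fun l _ => E l)).
rewrite exchange_big/= mulr_sumr /count_law rmorph_sum/=; apply: eq_bigr => w _.
rewrite -mulr_sumr rmorphM/= mulrCA; congr (_ * _).
rewrite -(bigA_distr_bigA (fun j (i : 'I_N) =>
  cis (grid (2 * pi / N%:R) i * ((tcount w j)%:R - (nu j)%:R)))).
rewrite (eq_bigr (fun j => N%:R * (tcount w j == nu j)%:R)); last first.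
  move=> j _; rewrite cis_grid_sum ?natrM//.
  rewrite -[leqRHS]card_ord -sum1_card; apply: leq_sum => i _.
  exact: leq_b1.
rewrite big_split/= prodr_const card_ord mulrA -exprMn mulVf ?pnatr_eq0//.
rewrite expr1n mul1r rmorph_nat; case: (boolP [forall j, tcount w j == nu j]) => [/forallP h|].
  by rewrite big1// => j _; rewrite h.
rewrite negb_forall => /existsP[j /negbTE jn].
by rewrite (bigD1 j)//= jn mul0r.
Qed.

Let sum_dev x : \sum_t q t * dev x t = 0.
Proof.
rewrite /dev; under eq_bigr do rewrite mulr_sumr.
rewrite exchange_big/=; apply: big1 => j _.
rewrite (eq_bigr (fun t => x j * (q t * (Y t j)%:R) - x j * mean j * q t)).
  by rewrite sumrB -!mulr_sumr q1 -/(mean j) mulr1 subrr.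
by move=> t _; ring.
Qed.

Let sum_dev2 x : \sum_t q t * dev x t ^+ 2 = qform covmx x.
Proof.
rewrite /qform.
rewrite (eq_bigr (fun t => \sum_i \sum_j
  x i * x j * (q t * ((Y t i)%:R - mean i) * ((Y t j)%:R - mean j)))); last first.
  move=> t _; rewrite expr2 /dev mulr_suml mulr_sumr; apply: eq_bigr => i _.
  by rewrite !mulr_sumr; apply: eq_bigr => j _; ring.
rewrite exchange_big/=; apply: eq_bigr => i _.
rewrite exchange_big/=; apply: eq_bigr => j _.
rewrite -mulr_sumr mxE -[RHS]mulrA [RHS]mulrC; congr (_ * _).
rewrite (eq_bigr (fun t => q t * ((Y t i)%:R * (Y t j)%:R) -
  mean j * (q t * (Y t i)%:R) - mean i * (q t * (Y t j)%:R) +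
  mean i * mean j * q t)); last by move=> t _; ring.
by rewrite big_split/= !sumrB -!mulr_sumr q1 -/(mean i) -/(mean j); ring.
Qed.

Lemma covmx_sym i j : covmx i j = covmx j i.
Proof.
rewrite !mxE [mean j * _]mulrC; congr (_ - _).
by apply: eq_bigr => t _; rewrite [X in _ * X]mulrC.
Qed.

(** Twice the variance is the mean squared difference of two independent copies. In this form single
    pairs of outcomes give lower bounds. *)
Let sum_pairs (F : T -> R) :
  \sum_s \sum_t q s * q t * (F s - F t) ^+ 2 =
  2 * (\sum_t q t * F t ^+ 2) - 2 * (\sum_t q t * F t) ^+ 2.
Proof.
rewrite (eq_bigr (fun s => q s * F s ^+ 2 - 2 * (q s * F s) * (\sum_t q t * F t) +
  q s * (\sum_t q t * F t ^+ 2))).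
  rewrite big_split/= sumrB -!mulr_suml -mulr_sumr q1; ring.
move=> s _.
rewrite (eq_bigr (fun t => q s * F s ^+ 2 * q t - 2 * (q s * F s) * (q t * F t) +
  q s * (q t * F t ^+ 2))); last by move=> t _; ring.
by rewrite big_split/= sumrB -!mulr_sumr q1 mulr1.
Qed.

Let mean01 j : 0 <= mean j <= 1.
Proof.
apply/andP; split; first by apply: sumr_ge0 => t _; rewrite mulr_ge0// ltW.
rewrite -[leRHS]q1; apply: ler_sum => t _; apply: ler_piMr; first exact: ltW.
by case: (Y t j).
Qed.

Let dev_le x t : `|dev x t| <= \sum_j `|x j|.
Proof.
apply: le_trans (ler_norm_sum _ _ _) _; apply: ler_sum => j _.
rewrite normrM ler_piMr// ler_norml; have := mean01 j.
by case: (Y t j) => /= /andP[? ?]; apply/andP; split; lra.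
Qed.

Let qform_cov_ge0 x : 0 <= qform covmx x.
Proof. by rewrite -sum_dev2 sumr_ge0// => t _; rewrite mulr_ge0 ?sqr_ge0 ?ltW. Qed.

Let qform_cov_le x : qform covmx x <= (\sum_j `|x j|) ^+ 2.
Proof.
rewrite -sum_dev2 -[leRHS]mul1r -q1 mulr_suml ler_sum// => t _.
rewrite ler_pM2l// -real_normK ?num_real// lerXn2r ?nnegrE//.
exact: sumr_ge0.
Qed.

(** Both terms are compared with [1 - v / 2]; the linear term of [phi] vanishes because [dev] is
    centred. *)
Let phi_taylor x : (forall j, `|x j| <= pi) ->
  Normc.normc (phi x - (expR (- (qform covmx x / 2)))%:C%C) <=
    (1 + k%:R) * (\sum_j `|x j|) ^+ 3.
Proof.
move=> xpi; set X := \sum_j _; have X0 : 0 <= X by exact: sumr_ge0.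
set v := qform covmx x.
have h1 : Normc.normc (phi x - (1 - v / 2)%:C%C) <= X ^+ 3.
  have -> : phi x - (1 - v / 2)%:C%C = \sum_t (q t)%:C%C *
      (cis (dev x t) - ((1 - dev x t ^+ 2 / 2) +i* dev x t)%C).
    under [RHS]eq_bigr do rewrite mulrBr.
    rewrite sumrB; congr (_ - _).
    rewrite (eq_bigr (fun t => (q t * (1 - dev x t ^+ 2 / 2))%:C%C +
       (q t * dev x t)%:C%C * 'i%C)); last first.
      by move=> t _; apply/eqP; rewrite eq_complex/= !mulr0 !mul0r !mulr1 !subr0 !addr0 !add0r !eqxx.
    rewrite big_split/= -mulr_suml -!rmorph_sum/= sum_dev mul0r addr0.
    congr (_%:C)%C; rewrite /v -sum_dev2 -{1}q1 mulr_suml -sumrB.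
    by apply: eq_bigr => t _; ring.
  apply: le_trans (normc_sum_le _ _ _) _.
  rewrite -[leRHS]mul1r -[X in _ <= X * _]q1 mulr_suml ler_sum// => t _.
  rewrite Normc.normcM normc_real gtr0_norm// ler_pM2l//.
  by apply: le_trans (normc_cis_taylor _) _; rewrite lerXn2r ?nnegrE// dev_le.
have h2 : Normc.normc ((1 - v / 2)%:C%C - (expR (- (v / 2)))%:C%C) <= k%:R * X ^+ 3.
  rewrite -rmorphB normc_real.
  have v0 : 0 <= v / 2 by rewrite divr_ge0// qform_cov_ge0.
  have u1 := expR_ge1Dx (- (v / 2)).
  (* For [u >= 0], [exp (- u) <= 1 / (1 + u) <= 1 - u + u^2], since
     [(1 + u) * (1 - u + u^2) = 1 + u^3]. *)
  have u2 : expR (- (v / 2)) <= 1 - v / 2 + (v / 2) ^+ 2.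
    rewrite expRN -[leLHS]mul1r ler_pdivrMr ?expR_gt0//.
    have w := expR_ge1Dx (v / 2).
    have : 0 <= 1 - v / 2 + (v / 2) ^+ 2 by nra.
    by nra.
  rewrite ler0_norm; last by lra.
  apply: (@le_trans _ _ ((v / 2) ^+ 2)); first by lra.
  have vX : v <= X ^+ 2 := qform_cov_le x.
  (* The quartic remainder [X^4 / 4] becomes cubic because [X] is bounded on the period cell, where
     [pi < 4]. *)
  have XK : X <= 4 * k%:R.
    rewrite /X (@le_trans _ _ (\sum_(j < k) 4))//.
      apply: ler_sum => j _; apply: (le_trans (xpi j)).
      by have := @pihalf_lt2 R; lra.
    by rewrite sumr_const card_ord mulr_natr.
  apply: (@le_trans _ _ ((X ^+ 2 / 2) ^+ 2)).
    have vX2 : v / 2 <= X ^+ 2 / 2 by rewrite ler_pM2r ?invr_gt0.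
    by rewrite lerXn2r ?nnegrE// divr_ge0 ?sqr_ge0.
  have -> : (X ^+ 2 / 2) ^+ 2 = X / 4 * X ^+ 3 by field.
  by rewrite ler_wpM2r ?exprn_ge0//; lra.
have -> : phi x - (expR (- (v / 2)))%:C%C = (phi x - (1 - v / 2)%:C%C) +
  ((1 - v / 2)%:C%C - (expR (- (v / 2)))%:C%C) by rewrite subrKA.
by apply: le_trans (normcD_le _ _) _; rewrite mulrDl mul1r lerD.
Qed.

(** The squared modulus is the mean of [cos (dev x s - dev x t)] over two independent copies, here
    written as a deficit from 1 with nonnegative terms. *)
Let normc_phi_sq x : Normc.normc (phi x) ^+ 2 =
  1 - \sum_s \sum_t q s * q t * (1 - cos (dev x s - dev x t)).
Proof.
have -> : phi x = ((\sum_t q t * cos (dev x t)) +i* (\sum_t q t * sin (dev x t)))%C.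
  rewrite [RHS]complexE/= !rmorph_sum/= mulr_sumr -big_split/=; apply: eq_bigr => t _.
  by apply/eqP; rewrite eq_complex/=; apply/andP; split; apply/eqP; ring.
rewrite /= sqr_sqrtr ?addr_ge0 ?sqr_ge0//.
set C := \sum_t q t * cos _; set S := \sum_t q t * sin _.
have -> : \sum_s \sum_t q s * q t * (1 - cos (dev x s - dev x t)) =
    \sum_s (q s - (q s * cos (dev x s) * C + q s * sin (dev x s) * S)).
  apply: eq_bigr => s _.
  rewrite (eq_bigr (fun t => q s * q t - (q s * cos (dev x s) * (q t * cos (dev x t)) +
    q s * sin (dev x s) * (q t * sin (dev x t))))); last by move=> t _; rewrite cosB; ring.
  by rewrite sumrB big_split/= -!mulr_sumr q1 mulr1.
by rewrite sumrB q1 big_split/= -!mulr_suml -/C -/S; ring.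
Qed.

(* Outcomes with count vectors 0 and the unit vectors make the law aperiodic and
   its covariance nondegenerate. *)
Variables (t0 : T) (e : 'I_k -> T).
Hypotheses (Yt0 : forall j, Y t0 j = false) (Ye : forall i j, Y (e i) j = (i == j)).

Let dev_pair x j : dev x (e j) - dev x t0 = x j.
Proof.
rewrite /dev -sumrB (bigD1 j)//= big1 => [|i ij].
  by rewrite addr0 Ye Yt0 eqxx/=; ring.
by rewrite Ye Yt0 eq_sym (negbTE ij) subrr.
Qed.

(** A product of probabilities is a positive lower bound for each factor, which replaces a
    minimum. *)
Let qmin := \prod_t q t.

Let qmin_gt0 : 0 < qmin.
Proof. by apply: prodr_gt0 => t _. Qed.

Let qmin_le t : qmin <= q t.
Proof.
rewrite /qmin (bigD1 t)//=; apply: ler_piMr; first exact: ltW.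
apply: prodr_ile1 => s _; rewrite ltW//= -q1 (bigD1 s)//= lerDl.
by apply: sumr_ge0 => u _; exact: ltW.
Qed.

(** Keep only the pairs [(e j, t0)], which are distinct since [e] is injective. By [dev_pair], each
    isolates one coordinate of [x]. *)
Let sum_pairs_ge (F : T -> T -> R) : (forall s t, 0 <= F s t) ->
  qmin ^+ 2 * \sum_j F (e j) t0 <= \sum_s \sum_t q s * q t * F s t.
Proof.
move=> F0.
have G0 s t : 0 <= q s * q t * F s t by rewrite !mulr_ge0// ltW.
have einj : injective e.
  by move=> i j /(congr1 (Y^~ j)); rewrite !Ye eqxx => /eqP.
apply: (@le_trans _ _ (\sum_s q s * q t0 * F s t0)); last first.
  by apply: ler_sum => s _; rewrite (bigD1 t0)//= lerDl sumr_ge0.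
apply: (@le_trans _ _ (\sum_(s in e @: 'I_k) q s * q t0 * F s t0)); last first.
  by rewrite [leRHS](bigID (mem (e @: 'I_k)))/= lerDl sumr_ge0.
rewrite big_imset/=; last by move=> i j _ _ /einj.
rewrite mulr_sumr ler_sum// => j _.
by rewrite ler_wpM2r// expr2 ler_pM// ltW.
Qed.

Lemma covmx_coercive : coercive covmx (qmin ^+ 2 / 2).
Proof.
move=> x; rewrite -sum_dev2.
have := sum_pairs (dev x); rewrite sum_dev expr0n/= mulr0 subr0 => H.
have := sum_pairs_ge (fun s t => sqr_ge0 (dev x s - dev x t)); rewrite H.
rewrite (eq_bigr (fun j => x j ^+ 2)); last by move=> j _; rewrite dev_pair.
by lra.
Qed.

(** The pairs kept give a deficit of at least [qmin^2 / 18] times the sum of squares; then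
    [1 - u <= exp (- u)], and the square root turns 18 into 36. *)
Let normc_phi_le x : (forall j, `|x j| <= pi) ->
  Normc.normc (phi x) <= expR (- (qmin ^+ 2 / 36 * \sum_j x j ^+ 2)).
Proof.
move=> xpi.
rewrite -(@ler_pXn2r _ 2)// ?nnegrE ?normc_ge0 ?expR_ge0//.
rewrite -expRM_natl normc_phi_sq.
apply: le_trans (expR_ge1Dx _); rewrite lerD2l.
have cos0 s t : 0 <= 1 - cos (dev x s - dev x t) by rewrite subr_ge0 cos_le1.
have := sum_pairs_ge cos0.
under eq_bigr do rewrite dev_pair.
have : \sum_j x j ^+ 2 / 18 <= \sum_j (1 - cos (x j)).
  by apply: ler_sum => j _; exact: cos_lt_quad.
rewrite -mulr_suml => h1 h2.
have : qmin ^+ 2 * ((\sum_j x j ^+ 2) / 18) <= qmin ^+ 2 * \sum_j (1 - cos (x j)).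
  by rewrite ler_pM2l// exprn_gt0.
by lra.
Qed.

(** The error may grow with the distance of [nu] from the mean, but only through a product over
    coordinates, which factors when summed against geometric weights. *)
Theorem local_limit_theorem :
  exists2 C, 0 < C & forall n (nu : 'I_k -> nat), (0 < n)%N -> (forall j, nu j <= n)%N ->
  `|Num.sqrt n%:R ^+ k * count_law n nu -
    (2 * pi) ^- k * gauss_lattice_sum covmx (Num.sqrt n%:R * (2 * pi / n.*2.+1%:R)) n|
  <= C * (\prod_j (1 + `|(nu j)%:R - n%:R * mean j|)) / Num.sqrt n%:R.
Proof.
(* A decay rate valid both for [phi] and for the Gaussian [w], whose own rate is [qmin^2 / 4]:
   [normc_exprB_le] requires a common bound. *)
pose c := qmin ^+ 2 / 36; have c0 : 0 < c by rewrite divr_gt0// exprn_gt0.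
have [C C0 HC] := @lattice_moment_bound R k c 4 c0 (ler0n _ _).
(* Differences of [m]-th powers leave [rho ^+ n] with [m = n.+1]. The constant [E] restores the
   missing factor, the squared angles being at most 16. *)
pose E := expR (c * (16 * k%:R)).
have E0 : 0 < E by exact: expR_gt0.
pose B := E * (1 + k%:R) + 1.
have B0 : 0 < B by rewrite ltr_pwDr// mulr_ge0 ?addr_ge0// ltW.
have p0 : 0 < (2 * pi) ^- k :> R by rewrite invr_gt0 exprn_gt0// mulr_gt0// pi_gt0.
exists ((2 * pi) ^- k * (B * C)); first by rewrite !mulr_gt0.
move=> [//|n] nu _ nun; set m := n.+1 in nun *.
set r := Num.sqrt m%:R.
have r0 : 0 < r by rewrite sqrtr_gt0 ltr0n.
have r2 : r ^+ 2 = m%:R by rewrite sqr_sqrtr.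
set N := m.*2.+1.
have N0 : 0 < N%:R :> R by rewrite ltr0n.
pose d : R := 2 * pi / N%:R.
have d0 : 0 < d by rewrite divr_gt0// mulr_gt0// pi_gt0.
set h := r * (2 * pi / N%:R).
have h0 : 0 < h by rewrite mulr_gt0.
have NE : N%:R = 2 * m%:R + 1 :> R by rewrite /N -natr1 -mul2n natrM.
have m1 : 1 <= m%:R :> R by rewrite ler1n.
have h4 : h <= 4.
  have rm : r <= m%:R.
    rewrite -r2 expr2 ler_peMr ?(ltW r0)//.
    by rewrite -(@ler_pXn2r _ 2)// ?nnegrE ?(ltW r0)// r2 expr1n.
  rewrite /h mulrA ler_pdivrMr// NE.
  have := @pihalf_lt2 R; have := @pi_gt0 R; nra.
pose th (l : {ffun 'I_k -> 'I_N}) j : R := grid d (l j).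
pose x (l : {ffun 'I_k -> 'I_N}) j : R := grid h (l j).
have xE l j : x l j = r * th l j by rewrite /x /th /grid /h /d; ring.
have thpi l j : `|th l j| <= pi.
  rewrite /th /grid normrM gtr0_norm//.
  have ln : (l j)%:R <= 2 * m%:R :> R.
    by rewrite -natrM ler_nat mul2n -ltnS ltn_ord.
  have l0 := ler0n R (l j).
  have : `|(l j)%:R - m%:R| <= m%:R :> R by rewrite ler_norml; apply/andP; split; lra.
  move=> H; rewrite /d mulrAC ler_pdivrMr// NE.
  have := @pi_gt0 R; have := normr_ge0 ((l j)%:R - m%:R : R); nra.
set D := \prod_j _.
have D1 : 1 <= D.
  by apply: prodr_ge1 => j; rewrite lerDl.
pose w l := expR (- (qform covmx (th l) / 2)).
pose dl l := \sum_j th l j * ((nu j)%:R - m%:R * mean j).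
have qE l : qform covmx (x l) = m%:R * qform covmx (th l).
  rewrite /qform mulr_sumr; apply: eq_bigr => i _; rewrite mulr_sumr.
  by apply: eq_bigr => j _; rewrite !xE -r2; ring.
have x2E l : \sum_j x l j ^+ 2 = m%:R * \sum_j th l j ^+ 2.
  by rewrite mulr_sumr; apply: eq_bigr => j _; rewrite xE exprMn r2.
have wE l : expR (- (qform covmx (x l) / 2)) = w l ^+ m.
  by rewrite /w -expRM_natl qE; congr expR; ring.
have w_le l : w l <= expR (- (c * \sum_j th l j ^+ 2)).
  rewrite ler_expR lerN2.
  have := covmx_coercive (th l).
  have : 0 <= qmin ^+ 2 * \sum_j th l j ^+ 2.
    by rewrite mulr_ge0 ?sqr_ge0// sumr_ge0// => j _; exact: sqr_ge0.
  rewrite /c; lra.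
(* Two successive replacements: [phi ^+ m] by the Gaussian [w ^+ m], then the phase [cis (- dl l)]
   by 1. *)
have L : (r ^+ k * count_law m nu - (2 * pi) ^- k * gauss_lattice_sum covmx h m)%:C%C =
   ((2 * pi) ^- k * h ^+ k)%:C%C * \sum_l ((phi (th l) ^+ m - (w l)%:C%C ^+ m) *
      cis (- dl l) + (w l)%:C%C ^+ m * (cis (- dl l) - 1)).
  rewrite rmorphB/= rmorphM/= count_law_inversion//.
  rewrite [X in _ = _ * X](_ : _ = \sum_l phi (th l) ^+ m * cis (- dl l) -
      \sum_l (w l ^+ m)%:C%C); last first.
    by rewrite -sumrB; apply: eq_bigr => l _; rewrite rmorphXn/=; ring.
  rewrite mulrBr; congr (_ - _).
    rewrite mulrA; congr (_ * _).
    have -> : (2 * pi) ^- k * h ^+ k = r ^+ k * N%:R^-1 ^+ k.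
      rewrite /h -exprVn -!exprMn; congr (_ ^+ _).
      by rewrite mulrCA mulKf// mulf_neq0// ?pnatr_eq0// gt_eqF// pi_gt0.
    rewrite rmorphM/=; congr (_ * _).
    by rewrite [RHS](rmorphXn (real_complex R)) (fmorphV (real_complex R)) rmorph_nat.
  rewrite /gauss_lattice_sum mulrA rmorphM/= rmorph_sum/=; congr (_ * _).
  by apply: eq_bigr => l _; rewrite -wE.
rewrite -normc_real L Normc.normcM normc_real ger0_norm; last first.
  by rewrite mulr_ge0 ?exprn_ge0 ?ltW.
rewrite -!mulrA ler_pM2l//.
apply: (@le_trans _ _ (h ^+ k * \sum_l (B * D / r *
   ((1 + \sum_j `|x l j|) ^+ 3 * expR (- (c * \sum_j x l j ^+ 2)))))); last first.
  rewrite -mulr_sumr mulrCA.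
  have -> : B * (C * (D / r)) = B * D / r * C by ring.
  rewrite ler_wpM2l//; last by apply: HC; rewrite h0.
  by rewrite !mulr_ge0 ?invr_ge0 ?(ltW r0) ?(ltW B0)// (le_trans _ D1).
rewrite ler_pM2l ?exprn_gt0//.
apply: le_trans (normc_sum_le _ _ _) _; apply: ler_sum => l _.
set X := \sum_j `|th l j|; have X0 : 0 <= X by exact: sumr_ge0.
have xX : \sum_j `|x l j| = r * X.
  by rewrite mulr_sumr; apply: eq_bigr => j _; rewrite xE normrM gtr0_norm.
set G := expR (- (c * \sum_j x l j ^+ 2)).
have G0 : 0 < G by exact: expR_gt0.
set rho := expR (- (c * \sum_j th l j ^+ 2)).
have rhoG : rho ^+ m = G by rewrite -expRM_natl /G x2E; congr expR; ring.
have rhonG : rho ^+ n <= E * G.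
  rewrite -rhoG exprS mulrA ler_peMl ?exprn_ge0 ?expR_ge0//.
  rewrite /E /rho -expRD -[leLHS]expR0 ler_expR -mulrBr mulr_ge0 ?(ltW c0)//.
  rewrite subr_ge0 (@le_trans _ _ (\sum_(j < k) 16))//.
    apply: ler_sum => j _; rewrite -real_normK ?num_real//.
    have := thpi l j; have := normr_ge0 (th l j).
    by have := @pihalf_lt2 R; nra.
  by rewrite sumr_const card_ord mulr_natr.
have wm : (w l) ^+ m <= G.
  by rewrite -rhoG lerXn2r ?nnegrE ?expR_ge0// w_le.
have n1 : Normc.normc ((phi (th l) ^+ m - (w l)%:C%C ^+ m) * cis (- dl l)) <=
    E * (1 + k%:R) * ((1 + r * X) ^+ 3 * G) / r.
  rewrite Normc.normcM normc_cis mulr1.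
  have := @normc_exprB_le R (phi (th l)) (w l)%:C%C rho n
    (normc_phi_le (thpi l)).
  rewrite normc_real ger0_norm ?expR_ge0// => /(_ (w_le l)) H.
  apply: (le_trans H).
  apply: (@le_trans _ _ (m%:R * (E * G) * ((1 + k%:R) * X ^+ 3))).
    apply: ler_pM; rewrite ?normc_ge0 ?mulr_ge0 ?exprn_ge0 ?expR_ge0//.
      by rewrite ler_pM2l// ltr0n.
    exact: phi_taylor.
  (* As [m = r^2], the cubic Taylor error satisfies [m * X^3 = (r * X)^3 / r]: this is where the
     rate [1 / sqrt m] comes from. *)
  have -> : m%:R * (E * G) * ((1 + k%:R) * X ^+ 3) =
      E * (1 + k%:R) * ((r * X) ^+ 3 * G) / r.
    by rewrite -r2; field; rewrite gt_eqF.
  rewrite ler_pM2r ?invr_gt0//; apply: ler_wpM2l.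
    by rewrite mulr_ge0 ?(ltW E0)// addr_ge0.
  rewrite ler_pM2r// lerXn2r ?nnegrE ?addr_ge0 ?mulr_ge0 ?(ltW r0)//.
  by rewrite lerDr.
have n2 : Normc.normc ((w l)%:C%C ^+ m * (cis (- dl l) - 1)) <=
    D * ((1 + r * X) ^+ 3 * G) / r.
  rewrite Normc.normcM normcX normc_real ger0_norm ?expR_ge0//.
  have dX : `|dl l| <= D * X.
    apply: le_trans (ler_norm_sum _ _ _) _; rewrite mulr_sumr.
    apply: ler_sum => j _; rewrite normrM mulrC ler_wpM2r//.
    rewrite /D (bigD1 j)//= -[leLHS]mulr1 ler_pM//; first by rewrite lerDr.
    by apply: prodr_ge1 => i; rewrite lerDl.
  apply: (@le_trans _ _ (G * (D * X))).
    apply: ler_pM; rewrite ?normc_ge0 ?exprn_ge0 ?expR_ge0//.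
    by apply: le_trans (normc_cisB1_le _) _; rewrite normrN.
  have -> : G * (D * X) = D * (r * X * G) / r by field; rewrite gt_eqF.
  rewrite ler_pM2r ?invr_gt0// ler_wpM2l ?(le_trans _ D1)// ler_pM2r//.
  have X1 : 1 <= 1 + r * X by rewrite lerDl mulr_ge0// ltW.
  rewrite (@le_trans _ _ (1 + r * X))//; first by rewrite lerDr.
  by rewrite -[leLHS]expr1 ler_weXn2l.
apply: le_trans (normcD_le _ _) _; apply: le_trans (lerD n1 n2) _.
rewrite -/x xX /B.
set Z := (1 + r * X) ^+ 3 * G.
have Z0 : 0 <= Z by rewrite mulr_ge0 ?(ltW G0)// exprn_ge0// addr_ge0// mulr_ge0// ltW.
rewrite -mulrDl [leRHS]mulrAC ler_pM2r ?invr_gt0// -mulrDl ler_wpM2r//.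
rewrite mulrDl mul1r lerD2r ler_peMr// mulr_ge0 ?addr_ge0// ltW//.
Qed.

End LocalLimit.

(** * The cumulant generating function *)

Section LogSumExp.
Context {R : realType} (T : finType).
Implicit Types (W c d : T -> R) (u v : R).

Lemma is_derive_expsum W c u :
  is_derive u 1 (fun v => \sum_r W r * expR (v * c r))
    (\sum_r W r * c r * expR (u * c r)).
Proof.
suff H (s : seq T) : is_derive u 1 (fun v => \sum_(r <- s) W r * expR (v * c r))
    (\sum_(r <- s) W r * c r * expR (u * c r)) by exact: H.
elim: s => [|r s ih].
  rewrite big_nil (_ : (fun _ => _) = cst 0); first exact: is_derive_cst.
  by apply/funext => v; rewrite big_nil.
rewrite big_cons (_ : (fun _ => _) = (fun v => W r * expR (v * c r)) +
    (fun v => \sum_(r <- s) W r * expR (v * c r))); last first.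
  by apply/funext => v; rewrite big_cons.
apply: is_deriveD.
have d1 : is_derive u 1 (fun v => v * c r) (c r).
  by apply: is_derive_eq; rewrite /GRing.scale/=; ring.
have d2 : is_derive u 1 (fun v => expR (v * c r)) (expR (u * c r) * c r).
  exact: (@is_derive1_comp R expR (fun v => v * c r)).
by apply: is_derive_eq; rewrite /GRing.scale/=; ring.
Qed.

Lemma is_derive_ln_expsum W c u : 0 < \sum_r W r * expR (u * c r) ->
  is_derive u 1 (fun v => ln (\sum_r W r * expR (v * c r)))
    ((\sum_r W r * c r * expR (u * c r)) / (\sum_r W r * expR (u * c r))).
Proof.
move=> Z0; have d1 := is_derive_expsum W c u.
have d2 := is_derive1_ln Z0.
have d3 := is_derive1_comp d2 d1.
by apply: (is_derive_eq d3); rewrite mulrC.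
Qed.

Lemma is_derive_expsum_ratio W c d u : 0 < \sum_r W r * expR (u * c r) ->
  is_derive u 1
    (fun v => (\sum_r W r * d r * expR (v * c r)) / (\sum_r W r * expR (v * c r)))
    ((\sum_r W r * d r * c r * expR (u * c r)) / (\sum_r W r * expR (u * c r)) -
     (\sum_r W r * d r * expR (u * c r)) * (\sum_r W r * c r * expR (u * c r)) /
       (\sum_r W r * expR (u * c r)) ^+ 2).
Proof.
move=> Z0; have Zn0 := lt0r_neq0 Z0.
have d1 := is_derive_expsum W c u.
have d2 := is_derive_expsum (fun r => W r * d r) c u.
have d3 : is_derive u 1 (fun v => (\sum_r W r * expR (v * c r))^-1)
    (- (\sum_r W r * expR (u * c r)) ^- 2 * (\sum_r W r * c r * expR (u * c r))).
  have d1' : derivable (fun v => \sum_r W r * expR (v * c r)) u 1 by [].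
  apply: DeriveDef; first exact: derivableV.
  by rewrite deriveV// derive_val.
have d4 := is_deriveM d2 d3.
apply: (@is_derive_eq _ _ _ _ _ _ _ _ d4); rewrite /GRing.scale/=.
by field.
Qed.

End LogSumExp.

(** * Exponential tilting of the vote and derivatives of the log characteristic polynomial *)

Section CharPoly.
Context {R : realType} {k : nat} (p : 'S_k.+1 -> R).
Implicit Types (t x : 'I_k -> R) (r : 'S_k.+1).

Definition pref r (j : 'I_k) : bool := above r (adv j) (cand_m k).

Lemma charpolyE x : charpoly p x = \sum_r p r * \prod_(j | pref r j) x j.
Proof.
rewrite /charpoly (partition_big (@adv_above k) xpredT)//=.
apply: eq_bigr => X _; rewrite /pX mulr_suml; apply: eq_bigr => r /eqP rX.
congr (_ * _); apply: eq_bigl => j.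
by rewrite -rX finset.in_set.
Qed.

Definition score t r : R := \sum_j t j * (pref r j)%:R.

Lemma charpoly_expR t : charpoly p (fun j => expR (t j)) = \sum_r p r * expR (score t r).
Proof.
rewrite charpolyE; apply: eq_bigr => r _; congr (_ * _).
rewrite /score expR_sum big_mkcond/=; apply: eq_bigr => j _.
by case: (pref r j); rewrite ?mulr1// mulr0 expR0.
Qed.

(** The Esscher transform of [p]. *)
Definition tilt t r : R := p r * expR (score t r) / charpoly p (fun j => expR (t j)).

Hypothesis p0 : forall r, 0 < p r.

Lemma charpoly_expR_gt0 t : 0 < charpoly p (fun j => expR (t j)).
Proof.
rewrite charpoly_expR (bigD1 1%g)//= ltr_pwDl ?mulr_gt0 ?expR_gt0//.
by apply: sumr_ge0 => r _; rewrite mulr_ge0 ?expR_ge0// ltW.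
Qed.

Lemma tilt_gt0 t r : 0 < tilt t r.
Proof. by rewrite divr_gt0 ?mulr_gt0 ?expR_gt0// charpoly_expR_gt0. Qed.

Lemma tilt_sum1 t : \sum_r tilt t r = 1.
Proof.
by rewrite -mulr_suml -charpoly_expR divff// lt0r_neq0// charpoly_expR_gt0.
Qed.

Lemma score_shift t j (u : R) r :
  score (fun l => t l + u * (j == l)%:R) r = score t r + u * (pref r j)%:R.
Proof.
rewrite /score; under eq_bigr do rewrite mulrDl.
rewrite big_split/=; congr (_ + _).
rewrite (bigD1 j)//= eqxx mulr1 big1 ?addr0// => l /negbTE lj.
by rewrite eq_sym lj mulr0 mul0r.
Qed.

Let cgf_shift t j u : cgf p (fun l => t l + u * (j == l)%:R) =
  ln (\sum_r p r * expR (score t r) * expR (u * (pref r j)%:R)).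
Proof.
rewrite /cgf charpoly_expR; congr ln; apply: eq_bigr => r _.
by rewrite score_shift expRD mulrA.
Qed.

Lemma is_derive_cgf t j (u : R) :
  is_derive u 1 (fun v => cgf p (fun l => t l + v * (j == l)%:R))
    (mean (tilt (fun l => t l + u * (j == l)%:R)) pref j).
Proof.
have ZE : \sum_r p r * expR (score t r) * expR (u * (pref r j)%:R) =
    charpoly p (fun l => expR (t l + u * (j == l)%:R)).
  by rewrite charpoly_expR; apply: eq_bigr => r _; rewrite score_shift expRD mulrA.
rewrite (_ : (fun v => _) = (fun v => ln (\sum_r p r * expR (score t r) *
    expR (v * (pref r j)%:R)))); last by apply/funext => v; rewrite cgf_shift.
apply: is_derive_eq.
  by apply: is_derive_ln_expsum; rewrite ZE charpoly_expR_gt0.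
rewrite ZE /mean mulr_suml; apply: eq_bigr => r _.
by rewrite /tilt score_shift expRD; ring.
Qed.

(** The log of a sum of exponentials has the tilted mean as gradient and the tilted covariance as
    Hessian. The inner derivative is computed for every [s], then differentiated as a quotient. *)
Lemma hessian_cgf t : hessian (cgf p) t = covmx (tilt t) pref.
Proof.
apply/matrixP => i j; rewrite !mxE.
pose W r := p r * expR (score t r).
have Zgt0 s : 0 < \sum_r W r * expR (s * (pref r i)%:R).
  rewrite (bigD1 1%g)//= ltr_pwDl ?mulr_gt0 ?expR_gt0//.
  by apply: sumr_ge0 => r _; rewrite !mulr_ge0 ?expR_ge0// ltW.
have E s : derive1 (fun u => cgf p (fun l => t l + s * (i == l)%:R + u * (j == l)%:R)) 0 =
    (\sum_r W r * (pref r j)%:R * expR (s * (pref r i)%:R)) /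
    (\sum_r W r * expR (s * (pref r i)%:R)).
  rewrite (_ : (fun u => _) = (fun u => ln (\sum_r
      (W r * expR (s * (pref r i)%:R)) * expR (u * (pref r j)%:R)))); last first.
    apply/funext => u; rewrite cgf_shift; congr ln; apply: eq_bigr => r _.
    by rewrite score_shift expRD /W !mulrA.
  have ZE : \sum_r W r * expR (s * (pref r i)%:R) * expR (0 * (pref r j)%:R) =
      \sum_r W r * expR (s * (pref r i)%:R).
    by apply: eq_bigr => r _; rewrite mul0r expR0 mulr1.
  have := @is_derive_ln_expsum R _ (fun r => W r * expR (s * (pref r i)%:R))
    (fun r => (pref r j)%:R) 0.
  rewrite ZE => /(_ (Zgt0 s)) D.
  rewrite derive1E derive_val; congr (_ / _); apply: eq_bigr => r _.
  by rewrite mul0r expR0 mulr1 mulrAC.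
under eq_fun do rewrite E.
have D := @is_derive_expsum_ratio R _ W (fun r => (pref r i)%:R)
  (fun r => (pref r j)%:R) 0 (Zgt0 0).
rewrite derive1E derive_val.
have e0 (f : 'S_k.+1 -> R) : \sum_r f r * expR (0 * (pref r i)%:R) = \sum_r f r.
  by apply: eq_bigr => r _; rewrite mul0r expR0 mulr1.
rewrite !e0 /W -charpoly_expR; set Z := charpoly _ _.
have Z0 : Z != 0 by rewrite lt0r_neq0// charpoly_expR_gt0.
have -> : mean (tilt t) pref i = (\sum_r p r * expR (score t r) * (pref r i)%:R) / Z.
  by rewrite mulr_suml; apply: eq_bigr => r _; rewrite /tilt -/Z mulrAC.
have -> : mean (tilt t) pref j = (\sum_r p r * expR (score t r) * (pref r j)%:R) / Z.
  by rewrite mulr_suml; apply: eq_bigr => r _; rewrite /tilt -/Z mulrAC.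
have -> : \sum_r tilt t r * ((pref r i)%:R * (pref r j)%:R) =
    (\sum_r p r * expR (score t r) * (pref r j)%:R * (pref r i)%:R) / Z.
  by rewrite mulr_suml; apply: eq_bigr => r _; rewrite /tilt -/Z; field.
by field.
Qed.

(** First-order condition at the maximum along coordinate [j], the gradient of [cgf] being the
    tilted mean. *)
Lemma mean_saddle t (beta : 'I_k -> R) :
  (forall x, - cgf p x + \sum_j beta j * x j <= - cgf p t + \sum_j beta j * t j) ->
  forall j, mean (tilt t) pref j = beta j.
Proof.
move=> tmax j.
pose f u := - cgf p (fun l => t l + u * (j == l)%:R) + \sum_l beta l * (t l + u * (j == l)%:R).
have lin u : \sum_l beta l * (t l + u * (j == l)%:R) =
    (\sum_l beta l * t l) + u * beta j.
  under eq_bigr do rewrite mulrDr.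
  rewrite big_split/=; congr (_ + _).
  rewrite (bigD1 j)//= eqxx mulr1 big1 ?addr0 1?mulrC// => l /negbTE lj.
  by rewrite eq_sym lj mulr0 mulr0.
have fd (u : R) : is_derive u 1 f
    (- mean (tilt (fun l => t l + u * (j == l)%:R)) pref j + beta j).
  have d1 := is_derive_cgf t j u.
  rewrite /f; under eq_fun do rewrite lin.
  by apply: is_derive_eq; rewrite /GRing.scale/=; ring.
have t0 : (fun l => t l + 0 * (j == l)%:R) = t by apply/funext => l; rewrite mul0r addr0.
have fmax u : f u <= f 0.
  by rewrite /f t0; under [X in _ <= _ + X]eq_bigr do rewrite mul0r addr0; exact: tmax.
have D0 : is_derive (0 : R) 1 f 0.
  apply: (@derive1_at_max R f (-1) 1 0) => //.
  by rewrite in_itv/= ltrN10 ltr01.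
have /eqP : 0 = - mean (tilt t) pref j + beta j.
  have D1 := fd 0; rewrite t0 in D1.
  by have [_ e0] := D0; have [_ <-] := D1; rewrite e0.
by rewrite addrC eq_sym subr_eq0 eq_sym => /eqP.
Qed.

End CharPoly.

(** * The tilted election *)

Section Election.
Context {R : realType} {k : nat} (p : 'S_k.+1 -> R).
Implicit Types (t : 'I_k -> R) (r : 'S_k.+1).

Lemma ranking_none : exists r, forall j : 'I_k, pref r j = false.
Proof.
exists (tperm (cand_m k) ord0) => j.
by rewrite /pref /above tpermL ltn0.
Qed.

Lemma adv_inj : injective (@adv k).
Proof. by move=> i j /(congr1 val)/= ij; apply: val_inj. Qed.

Lemma adv_neq_cand (j : 'I_k) : adv j != cand_m k.
Proof. by rewrite -val_eqE/= neq_ltn ltn_ord. Qed.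

(** With candidate [m] in second position exactly one candidate precedes it; the second
    transposition makes it [adv i]. *)
Lemma ranking_single (i : 'I_k) : exists r, forall j, pref r j = (i == j).
Proof.
have k0 : (0 < k)%N by case: k i => [[]|].
pose one : 'I_k.+1 := inord 1.
have oneE : one = 1%N :> nat by rewrite inordK.
pose r1 := tperm (cand_m k) one; pose x := r1 (adv i).
have x1 : x != one.
  by rewrite /x -(tpermL (cand_m k) one) (inj_eq perm_inj) adv_neq_cand.
pose r := (r1 * tperm x ord0)%g; exists r => j.
have rm : r (cand_m k) = one.
  rewrite permM tpermL tpermD// 1?eq_sym//.
  by rewrite -val_eqE/= oneE.
have ri : r (adv i) = ord0 by rewrite permM tpermL.
rewrite /pref /above rm oneE ltnS leqn0.
rewrite -(inj_eq adv_inj) -(inj_eq (@perm_inj _ r)) ri.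
by rewrite -val_eqE/= eq_sym.
Qed.

(** Each voter ranks [m] either above or below [j], so the strict threshold on the former count is a
    strict threshold on the latter; an integer is below a real exactly when it is below its
    ceiling. *)
Lemma alpha_winnerE (alpha : 'I_k -> R) n (w : {ffun 'I_n -> 'S_k.+1}) (b : 'I_k -> nat) :
  (forall j, (b j)%:Z = Num.ceil ((1 - alpha j) * n%:R)) ->
  alpha_winner alpha w = [forall j, (tcount pref w j < b j)%N].
Proof.
move=> bE; rewrite /alpha_winner; apply: eq_forallb => j.
set c := #|_|.
have cE : (c + tcount pref w j)%N = n.
  rewrite /c -sum1_card big_mkcond/= /tcount -big_split/=.
  rewrite (eq_bigr (fun=> 1%N)) ?sum1_card ?card_ord// => i _.
  rewrite finset.in_set /pref /above.
  have : w i (adv j) != w i (cand_m k) by rewrite (inj_eq perm_inj) adv_neq_cand.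
  by rewrite -val_eqE/= => /negbTE H; case: ltngtP H.
have nE : n%:R = c%:R + (tcount pref w j)%:R :> R by rewrite -natrD cE.
by rewrite -ltz_nat bE ceil_gt_int -pmulrn nE; apply/idP/idP; lra.
Qed.

(** The cut-off at [b] encodes the winning condition, and the exponent is the distance to the
    largest winning count [b - 1]. *)
Definition edge_weight (z : R) (b s : nat) : R := if (s < b)%N then z ^+ (b.-1 - s) else 0.

Hypothesis p0 : forall r, 0 < p r.

(** Change of measure: over a whole profile the score factors collect into powers of [expR (t j)]
    with the counts as exponents. *)
Lemma prob_winner_tilt (alpha : 'I_k -> R) t n (b : 'I_k -> nat) :
  (forall j, (b j)%:Z = Num.ceil ((1 - alpha j) * n%:R)) ->
  (\prod_j expR (t j) ^+ (b j).-1) * prob_winner p alpha n =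
  charpoly p (fun j => expR (t j)) ^+ n *
  \sum_(nu : {ffun 'I_k -> 'I_n.+1}) (\prod_j edge_weight (expR (t j)) (b j) (nu j)) *
    count_law (tilt p t) pref n (fun j => nu j).
Proof.
move=> bE; set Z := charpoly _ _.
have Z0 : Z != 0 by rewrite lt0r_neq0// charpoly_expR_gt0.
rewrite /count_law.
under [X in _ = _ * X]eq_bigr do rewrite mulr_sumr.
rewrite exchange_big/= /prob_winner !mulr_sumr; apply: eq_bigr => w _.
rewrite (alpha_winnerE w bE).
have tle j : (tcount pref w j < n.+1)%N.
  rewrite ltnS -[leqRHS]card_ord -sum1_card; apply: leq_sum => i _.
  exact: leq_b1.
pose nu0 : {ffun 'I_k -> 'I_n.+1} := [ffun j => Ordinal (tle j)].
have nu0E : [forall j, tcount pref w j == nu0 j].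
  by apply/forallP => j; rewrite ffunE.
(* Each profile has a single count vector [nu0], so only one term of the sum over [nu] survives. *)
rewrite (bigD1 nu0)//= nu0E mulr1 [X in _ = _ * (_ + X)]big1 => [|nu nun]; last first.
  rewrite (_ : [forall j, _] = false) ?mulr0//; apply/negP => /forallP H.
  case/eqP: nun; apply/ffunP => j; apply: val_inj => /=.
  by rewrite ffunE/=; apply/esym/eqP.
rewrite addr0.
have pE : \prod_i p (w i) * \prod_j expR (t j) ^+ tcount pref w j =
    Z ^+ n * \prod_i tilt p t (w i).
  have -> : \prod_j expR (t j) ^+ tcount pref w j = \prod_i expR (score t (w i)).
    rewrite -expR_sum /score exchange_big/= expR_sum; apply: eq_bigr => j _.
    by rewrite -mulr_sumr -natr_sum -/(tcount pref w j) expRM_natr.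
  have -> : Z ^+ n = \prod_(i < n) Z by rewrite prodr_const card_ord.
  rewrite -!big_split/=; apply: eq_bigr => i _.
  by rewrite /tilt -/Z [RHS]mulrC divfK.
have [/forallP H|/forallPn[j H]] := boolP [forall j, (tcount pref w j < b j)%N].
  rewrite mulr1 [\prod_j edge_weight _ _ _](_ : _ =
    \prod_j expR (t j) ^+ ((b j).-1 - tcount pref w j)); last first.
    by apply: eq_bigr => j _; rewrite /edge_weight ffunE/= H.
  rewrite [RHS]mulrCA -pE [RHS]mulrCA [LHS]mulrC; congr (_ * _).
  rewrite -big_split/=; apply: eq_bigr => j _.
  by rewrite -exprD subnK//; have := H j; case: (b j).
rewrite !mulr0 (bigD1 j)//= /edge_weight ffunE/= (negbTE H).
by rewrite !(mul0r, mulr0).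
Qed.

End Election.

(** * Sums and first moments of the geometric weights *)

Section EdgeWeights.
Context {R : realType}.
Implicit Types (z x : R) (b n : nat).

Lemma edge_weight_sum z b n (F : nat -> R) : (b <= n.+1)%N ->
  \sum_(s < n.+1) edge_weight z b s * F s = \sum_(m < b) z ^+ m * F (b.-1 - m)%N.
Proof.
move=> bn.
rewrite (eq_bigr (fun s : 'I_n.+1 => if (s < b)%N then z ^+ (b.-1 - s) * F s else 0)).
  rewrite -big_mkcond/= -(big_ord_widen _ (fun s => z ^+ (b.-1 - s) * F s))//.
  rewrite (reindex_inj rev_ord_inj)/=; apply: eq_bigr => m _.
  case: b m {bn} => [[]//|b] m /=; rewrite subSS.
  by rewrite subKn// -ltnS.
by move=> s _; rewrite /edge_weight; case: ifP; rewrite ?mul0r.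
Qed.

Lemma edge_weight_total z b n : z != 1 -> (b <= n.+1)%N ->
  \sum_(s < n.+1) edge_weight z b s = (1 - z ^+ b) / (1 - z).
Proof.
move=> z1 bn; under eq_bigr do rewrite -[edge_weight _ _ _]mulr1.
rewrite (edge_weight_sum _ (fun=> 1) bn).
have z10 : 1 - z != 0 by rewrite subr_eq0 eq_sym.
apply: (mulIf z10); rewrite divfK// -[RHS]opprB subrX1.
by under eq_bigr do rewrite mulr1; ring.
Qed.

Lemma arith_geometric_le z b : 0 <= z < 1 ->
  \sum_(m < b) z ^+ m * m.+1%:R <= (1 - z) ^- 2.
Proof.
move=> /andP[z0 z1]; have z10 : 0 < 1 - z by rewrite subr_gt0.
have E : (1 - z) ^+ 2 * (\sum_(m < b) z ^+ m * m.+1%:R) =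
    1 - b.+1%:R * z ^+ b + b%:R * z ^+ b.+1.
  elim: b => [|b ih]; first by rewrite big_ord0 mulr0 expr0; ring.
  by rewrite big_ord_recr/= mulrDr ih !exprS -!natr1; ring.
rewrite -[leRHS]mul1r ler_pdivlMr ?exprn_gt0// mulrC E.
have zb : 0 <= z ^+ b by rewrite exprn_ge0.
rewrite exprS -natr1; have := ler0n R b; move: (z ^+ b) (b%:R : R) zb => u v u0 v0.
have : v * (z * u) <= v * u by rewrite ler_wpM2l// ler_piMl// ltW.
by nra.
Qed.

(** At distance [m] below [b - 1], a count is within [m + 1] of [x], so the sum is at most twice an
    arithmetico-geometric one. *)
Lemma edge_weight_moment z b n x : 0 <= z < 1 -> (0 < b <= n.+1)%N ->
  b.-1%:R <= x <= b%:R ->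
  \sum_(s < n.+1) edge_weight z b s * (1 + `|s%:R - x|) <= 2 * (1 - z) ^- 2.
Proof.
move=> z01 /andP[b0 bn] /andP[bx xb].
rewrite (edge_weight_sum _ (fun s => 1 + `|s%:R - x|) bn).
apply: le_trans (ler_wpM2l _ (arith_geometric_le b z01)); last by [].
have z0 : 0 <= z by case/andP: z01.
rewrite mulr_sumr; apply: ler_sum => m _; rewrite mulrCA ler_wpM2l ?exprn_ge0//.
have mb : (m <= b.-1)%N by rewrite -ltnS prednK.
rewrite natrB// -natr1.
have bE : b%:R = b.-1%:R + 1 :> R by rewrite natr1 prednK.
have m0 := ler0n R m.
have : `|b.-1%:R - m%:R - x| <= m%:R + 1 by rewrite ler_norml; apply/andP; split; lra.
by lra.
Qed.

End EdgeWeights.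

(** * Asymptotics *)

Section Limits.
Context {R : realType}.

Lemma cvg_prod_fin (I : finType) (f : I -> nat -> R) (l : I -> R) :
  (forall i, f i n @[n --> \oo] --> l i) ->
  (\prod_i f i n) @[n --> \oo] --> \prod_i l i.
Proof.
move=> fl.
suff H (s : seq I) : (\prod_(i <- s) f i n) @[n --> \oo] --> \prod_(i <- s) l i by exact: H.
elim: s => [|i s ih].
  by rewrite big_nil; under eq_fun do rewrite big_nil; exact: cvg_cst.
by rewrite big_cons; under eq_fun do rewrite big_cons; exact: cvgM.
Qed.

Lemma sqrtrXn (x : R) n : 0 <= x -> Num.sqrt (x ^+ n) = Num.sqrt x ^+ n.
Proof.
move=> x0; elim: n => [|n ih]; first by rewrite !expr0 sqrtr1.
by rewrite !exprS sqrtrM// ih.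
Qed.

Lemma cvg_invsqrt : (Num.sqrt n.+1%:R)^-1 @[n --> \oo] --> (0 : R).
Proof.
rewrite -[X in _ --> X](@sqrtr0 R).
rewrite (_ : (fun n => _) = (fun n => Num.sqrt (@harmonic R n))); last first.
  by apply/funext => n; rewrite /= sqrtrV.
by apply: continuous_cvg; [exact: sqrt_continuous|exact: cvg_harmonic].
Qed.

Lemma cvg0_le (f g : nat -> R) (l : R) : (forall n, `|f n - l| <= g n) ->
  g n @[n --> \oo] --> 0 -> f n @[n --> \oo] --> l.
Proof.
move=> fg g0; rewrite -[X in _ --> X]add0r.
rewrite (_ : f = (fun n => f n - l) \+ cst l); last first.
  by apply/funext => n /=; rewrite subrK.
apply: cvgD; last exact: cvg_cst.
apply: norm_cvg0.
apply: (@squeeze_cvgr _ _ _ _ (cst 0) g) => //; last exact: cvg_cst.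
by apply: nearW => n /=; rewrite normr_ge0 fg.
Qed.

Let mesh n : R := Num.sqrt n.+1%:R * (2 * pi / n.+1.*2.+1%:R).

Let sqrt0 n : 0 < Num.sqrt (n.+1%:R : R).
Proof. by rewrite sqrtr_gt0 ltr0n. Qed.

Let sqrt1 n : 1 <= Num.sqrt (n.+1%:R : R).
Proof. by rewrite -{1}(@sqrtr1 R) ler_wsqrtr// ler1n. Qed.

Let mesh_gt0 n : 0 < mesh n.
Proof. by rewrite !mulr_gt0 ?invr_gt0 ?pi_gt0// ltr0n. Qed.

Let odd_natr n : n.+1.*2.+1%:R = 2 * n.+1%:R + 1 :> R.
Proof. by rewrite -natr1 -mul2n natrM. Qed.

Let mesh_le n : mesh n <= 4 * (Num.sqrt n.+1%:R)^-1.
Proof.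
rewrite ler_pdivlMr// /mesh mulrAC -expr2 sqr_sqrtr// mulrA ler_pdivrMr ?ltr0n//.
rewrite odd_natr; have := @pihalf_lt2 R; have := @pi_gt0 R; have := ler0n R n.+1; nra.
Qed.

Let meshV_le n : (mesh n * n.+1%:R)^-1 <= (Num.sqrt n.+1%:R)^-1.
Proof.
have m0 : 0 < mesh n * n.+1%:R by rewrite mulr_gt0// ltr0n.
rewrite lef_pV2 ?posrE//.
have -> : mesh n * n.+1%:R =
    Num.sqrt n.+1%:R * (2 * pi * n.+1%:R / n.+1.*2.+1%:R) by rewrite /mesh; ring.
rewrite ler_peMr ?(ltW (sqrt0 _))//.
rewrite ler_pdivlMr ?ltr0n// odd_natr mul1r.
have := @pi_ge2 R; have : 1 <= n.+1%:R :> R by rewrite ler1n.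
nra.
Qed.

(** The rescaled Fourier mesh is of order [1 / sqrt n] and the half-width of the box of order
    [sqrt n]. *)
Lemma gauss_lattice_sum_mesh_cvg k (A : 'M[R]_k) lambda : 0 < lambda ->
  (forall i j, A i j = A j i) -> coercive A lambda ->
  gauss_lattice_sum A (Num.sqrt n.+1%:R * (2 * pi / n.+1.*2.+1%:R)) n.+1
    @[n --> \oo] --> Num.sqrt ((2 * pi) ^+ k) / Num.sqrt (\det A).
Proof.
move=> l0 Asym cA.
apply: (@gauss_lattice_sum_cvg R k A lambda 4 mesh (fun n => n.+1)) => //.
- move=> n; rewrite mesh_gt0 (le_trans (mesh_le n))//.
  by rewrite ler_pdivrMr// ler_peMr.
- apply: (@cvg0_le _ (fun n => 4 * (Num.sqrt n.+1%:R)^-1)) => [n|].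
    by rewrite subr0 gtr0_norm.
  by rewrite -[X in _ --> X](mulr0 4); apply: cvgMl_tmp; exact: cvg_invsqrt.
- apply: (@cvg0_le _ (fun n => (Num.sqrt n.+1%:R)^-1)) => [n|].
    by rewrite subr0 gtr0_norm// invr_gt0 mulr_gt0// ltr0n.
  exact: cvg_invsqrt.
Qed.

End Limits.

(** * Limit of the geometrically weighted local probabilities *)

Section EdgeSum.
Context {R : realType} (k : nat) (T : finType) (q : T -> R) (Y : T -> 'I_k -> bool).
Hypotheses (q0 : forall t, 0 < q t) (q1 : \sum_t q t = 1).
Variables (t0 : T) (e : 'I_k -> T).
Hypotheses (Yt0 : forall j, Y t0 j = false) (Ye : forall i j, Y (e i) j = (i == j)).
Variables (z : 'I_k -> R) (b : nat -> 'I_k -> nat).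
Hypotheses (z01 : forall j, 0 < z j < 1).
Hypotheses (b_itv : forall n j, (0 < b n j <= n.+1)%N).
Hypotheses (b_mean : forall n j, (b n j).-1%:R <= n.+1%:R * mean q Y j <= (b n j)%:R).

Definition edge_sum n : R := \sum_(nu : {ffun 'I_k -> 'I_n.+2})
  (\prod_j edge_weight (z j) (b n j) (nu j)) * count_law q Y n.+1 (fun j => nu j).

Let mean_gt0 j : 0 < mean q Y j.
Proof.
rewrite /mean (bigD1 (e j))//= Ye eqxx mulr1 ltr_pwDl// sumr_ge0// => t _.
by rewrite mulr_ge0// ltW.
Qed.

Let edge_total_cvg :
  \prod_j ((1 - z j ^+ b n j) / (1 - z j)) @[n --> \oo] --> \prod_j (1 - z j)^-1.
Proof.
apply: cvg_prod_fin => j; rewrite -[X in _ --> X]mul1r; apply: cvgMr_tmp.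
rewrite -[X in _ --> X]subr0; apply: cvgB; first exact: cvg_cst.
have /andP[z0 z1] := z01 j.
(* Since [b n j] is at least [n.+1] times the positive mean, [z j ^+ b n j] is at most [w ^+ n.+1]
   with [w < 1]. *)
pose w := expR (ln (z j) * mean q Y j).
have w1 : `|w| < 1.
  by rewrite ger0_norm ?expR_ge0// expR_lt1 pmulr_llt0// ln_lt0// z0.
apply: (@cvg0_le _ _ (fun n => w ^+ n.+1)) => [n|]; last first.
  by rewrite (cvg_shiftS (fun n => w ^+ n)); exact: cvg_expr.
rewrite subr0 ger0_norm ?exprn_ge0 ?(ltW z0)//.
rewrite -{1}(lnK (_ : z j \is Num.pos))// -!expRM_natl ler_expR.
have /andP[_ nb] := b_mean n j.
rewrite [leRHS]mulrCA [leRHS]mulrC [leLHS]mulrC.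
by rewrite [leLHS]mulrC ler_wnM2r// ltW// ln_lt0// z0.
Qed.

(** Replace each scaled local probability by [L n], which does not depend on [nu]: the main term
    becomes [L n] times the total weight [W n], and the error is [1 / sqrt n] times a product of
    bounded weight moments. *)
Lemma edge_sum_cvg : Num.sqrt n.+1%:R ^+ k * edge_sum n @[n --> \oo] -->
  (Num.sqrt ((2 * pi) ^+ k * \det (covmx q Y)))^-1 * \prod_j (1 - z j)^-1.
Proof.
have [C C0 HC] := local_limit_theorem q0 q1 Yt0 Ye.
have cA := covmx_coercive q0 q1 Yt0 Ye.
have l0 : 0 < (\prod_t q t) ^+ 2 / 2 by rewrite divr_gt0// exprn_gt0// prodr_gt0.
have gcvg := gauss_lattice_sum_mesh_cvg l0 (covmx_sym q Y) cA.
have det0 := coercive_det_gt0 l0 (covmx_sym q Y) cA.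
set G := fun n => gauss_lattice_sum _ _ _ in gcvg.
pose L n := (2 * pi) ^- k * G n.
have pik0 : 0 < (2 * pi) ^+ k :> R by rewrite exprn_gt0// mulr_gt0// pi_gt0.
have Lcvg : L n @[n --> \oo] --> (Num.sqrt ((2 * pi) ^+ k * \det (covmx q Y)))^-1.
  have -> : (Num.sqrt ((2 * pi) ^+ k * \det (covmx q Y)))^-1 =
      (2 * pi) ^- k * (Num.sqrt ((2 * pi) ^+ k) / Num.sqrt (\det (covmx q Y))).
    rewrite sqrtrM ?ltW// -{2}(sqr_sqrtr (ltW pik0)).
    by field; rewrite !gt_eqF// sqrtr_gt0.
  exact: cvgMl_tmp.
pose W n := \prod_j ((1 - z j ^+ b n j) / (1 - z j)).
pose K := C * \prod_j (2 * (1 - z j) ^- 2).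
have err n : `|Num.sqrt n.+1%:R ^+ k * edge_sum n - L n * W n| <=
    K * (Num.sqrt n.+1%:R)^-1.
  have WE : W n = \sum_(nu : {ffun 'I_k -> 'I_n.+2})
      \prod_j edge_weight (z j) (b n j) (nu j).
    rewrite -(bigA_distr_bigA (fun j (s : 'I_n.+2) => edge_weight (z j) (b n j) s)).
    apply: eq_bigr => j _; have /andP[_ z1] := z01 j; have /andP[_ bn] := b_itv n j.
    by rewrite edge_weight_total ?lt_eqF// leqW.
  have w0 j s : 0 <= edge_weight (z j) (b n j) s.
    rewrite /edge_weight; case: ifP => // _; rewrite exprn_ge0//.
    by have /andP[/ltW] := z01 j.
  have -> : Num.sqrt n.+1%:R ^+ k * edge_sum n - L n * W n =
      \sum_(nu : {ffun 'I_k -> 'I_n.+2}) (\prod_j edge_weight (z j) (b n j) (nu j)) *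
       (Num.sqrt n.+1%:R ^+ k * count_law q Y n.+1 (fun j => nu j) - L n).
    rewrite WE /edge_sum !mulr_sumr -sumrB; apply: eq_bigr => nu _; ring.
  apply: le_trans (ler_norm_sum _ _ _) _.
  apply: (@le_trans _ _ (\sum_(nu : {ffun 'I_k -> 'I_n.+2}) C / Num.sqrt n.+1%:R *
     \prod_j (edge_weight (z j) (b n j) (nu j) *
       (1 + `|(nu j)%:R - n.+1%:R * mean q Y j|)))).
    apply: ler_sum => nu _; rewrite normrM ger0_norm; last first.
      by apply: prodr_ge0 => j _.
    rewrite big_split/= mulrCA ler_wpM2l//; first by apply: prodr_ge0 => j _.
    rewrite mulrAC; apply: HC => // j.
    by rewrite -ltnS ltn_ord.
  rewrite -mulr_sumr -(bigA_distr_bigA (fun j (s : 'I_n.+2) =>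
    edge_weight (z j) (b n j) s * (1 + `|s%:R - n.+1%:R * mean q Y j|))).
  rewrite /K [leRHS]mulrAC ler_wpM2l//; first by rewrite divr_ge0// ltW.
  apply: ler_prod => j _; rewrite sumr_ge0/= => [|s _]; last by rewrite mulr_ge0.
  have /andP[z0 z1] := z01 j; have /andP[b0 bn] := b_itv n j.
  apply: edge_weight_moment; last exact: b_mean.
    by rewrite (ltW z0) z1.
  by rewrite b0 leqW.
rewrite (_ : (fun n => _) = (fun n => (Num.sqrt n.+1%:R ^+ k * edge_sum n - L n * W n)) \+
   (fun n => L n * W n)); last by apply/funext => n /=; rewrite subrK.
rewrite -[X in _ --> X]add0r; apply: cvgD; last by apply: cvgM.
apply: (@cvg0_le _ _ (fun n => K * (Num.sqrt n.+1%:R)^-1)) => [n|].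
  by rewrite subr0.
by rewrite -[X in _ --> X](mulr0 K); apply: cvgMl_tmp; exact: cvg_invsqrt.
Qed.

End EdgeSum.

Unset Implicit Arguments.

Theorem theorem1 (R : realType) (k : nat) (hk : (0 < k)%N)
  (p : 'S_k.+1 -> R) (hp : forall r, 0 < p r) (hp1 : \sum_r p r = 1)
  (alpha : 'I_k -> R) (ha : forall j, 0 < alpha j < 1)
  (tau : 'I_k -> R)
  (htau : forall t : 'I_k -> R,
     - cgf p t + \sum_j (1 - alpha j) * t j
       <= - cgf p tau + \sum_j (1 - alpha j) * tau j)
  (hsub : forall j, expR (tau j) < 1) :
  (fun n : nat => prob_winner p alpha n /
     (charpoly p (fun j => expR (tau j)) ^+ n
      / (\prod_j ((1 - expR (tau j))
                   * expR (tau j) ^ (Num.ceil ((1 - alpha j) * n%:R) - 1)))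
      / Num.sqrt ((2 * pi * n%:R) ^+ k * \det (hessian (cgf p) tau))))
  @ \oo --> (1 : R).
Proof.
pose q := tilt p tau.
have q0 : forall r, 0 < q r by exact: tilt_gt0.
have q1 : \sum_r q r = 1 by exact: tilt_sum1.
have mE : forall j, mean q pref j = 1 - alpha j by exact: mean_saddle.
have [r0 r0P] := @ranking_none k.
have [e eP] := choice (@ranking_single k).
pose z j := expR (tau j).
have z01 j : 0 < z j < 1 by rewrite expR_gt0 hsub.
(* The index is shifted to [n.+1] so that every ceiling is positive; the absolute value then changes
   nothing and [b n j - 1] is a natural exponent. *)
pose b n j := `|Num.ceil ((1 - alpha j) * n.+1%:R)|%N.
have beta0 j : 0 < 1 - alpha j by rewrite subr_gt0; have /andP[] := ha j.
have ceil0 n j : 0 < Num.ceil ((1 - alpha j) * n.+1%:R).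
  by rewrite ceil_gt0 mulr_gt0.
have bE n j : (b n j)%:Z = Num.ceil ((1 - alpha j) * n.+1%:R).
  by rewrite /b gez0_abs// ltW.
have b_pos n j : (0 < b n j)%N by rewrite -ltz_nat bE.
have bB1 n j : (b n j)%:Z - 1 = (b n j).-1%:Z.
  by case: (b n j) (b_pos n j) => // c _; rewrite intS addrC addKr.
have b_itv n j : (0 < b n j <= n.+1)%N.
  rewrite b_pos/= -lez_nat bE ceil_le_int -pmulrn ler_piMl//.
  by rewrite lerBlDr lerDl; have /andP[/ltW] := ha j.
have b_mean n j : (b n j).-1%:R <= n.+1%:R * mean q pref j <= (b n j)%:R.
  rewrite mE mulrC; have := ceil_itv ((1 - alpha j) * n.+1%:R).
  by rewrite -bE bB1 -!pmulrn => /andP[/ltW -> ->].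
have S := edge_sum_cvg q0 q1 r0P eP z01 b_itv b_mean.
have det0 : 0 < \det (covmx q pref).
  apply: (coercive_det_gt0 _ (covmx_sym q pref) (covmx_coercive q0 q1 r0P eP)).
  by rewrite divr_gt0// exprn_gt0// prodr_gt0.
set D := (2 * pi) ^+ k * \det (covmx q pref) in S.
have D0 : 0 < D by rewrite mulr_gt0// exprn_gt0// mulr_gt0// pi_gt0.
(* The inverse of the limit in [S]. Once the powers of [Z], [z j] and [n] cancel, the ratio is the
   sequence of [S] times [kappa]. *)
pose kappa := \prod_j (1 - z j) * Num.sqrt D.
have Z0 := charpoly_expR_gt0 hp tau.
have prodz0 : \prod_j (1 - z j) != 0.
  by rewrite lt0r_neq0// prodr_gt0// => j _; rewrite subr_gt0; have /andP[] := z01 j.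
rewrite -cvg_shiftS.
rewrite (_ : [sequence _]_n = (fun n => Num.sqrt n.+1%:R ^+ k *
    edge_sum q pref z b n * kappa)); last first.
  apply/funext => n /=; rewrite hessian_cgf// -/q.
  set Z := charpoly _ _ in Z0 *.
  have pow0 : \prod_j z j ^+ (b n j).-1 != 0.
    rewrite lt0r_neq0// prodr_gt0// => j _; rewrite exprn_gt0//.
    by have /andP[] := z01 j.
  have -> : prob_winner p alpha n.+1 =
      Z ^+ n.+1 * edge_sum q pref z b n / \prod_j z j ^+ (b n j).-1.
    by rewrite /edge_sum -(prob_winner_tilt hp tau (bE n)) mulrC mulKf.
  have -> : \prod_j ((1 - expR (tau j)) *
       expR (tau j) ^ (Num.ceil ((1 - alpha j) * n.+1%:R) - 1)) =
      \prod_j (1 - z j) * \prod_j z j ^+ (b n j).-1.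
    rewrite -big_split/=; apply: eq_bigr => j _; congr (_ * _).
    by rewrite -bE bB1.
  have -> : Num.sqrt ((2 * pi * n.+1%:R) ^+ k * \det (covmx q pref)) =
      Num.sqrt n.+1%:R ^+ k * Num.sqrt D.
    rewrite exprMn -mulrA mulrCA sqrtrM ?exprn_ge0// -/D; congr (_ * _).
    by rewrite sqrtrXn.
  have Zn0 : Z ^+ n.+1 != 0 by rewrite expf_neq0// lt0r_neq0.
  have s0 : Num.sqrt n.+1%:R ^+ k != 0 :> R.
    by rewrite expf_neq0// lt0r_neq0// sqrtr_gt0 ltr0n.
  have sD0 : Num.sqrt D != 0 by rewrite lt0r_neq0// sqrtr_gt0.
  rewrite /kappa.
  move: (Z ^+ n.+1) (\prod_j z j ^+ _) (Num.sqrt n.+1%:R ^+ k) (Num.sqrt D)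
    (\prod_j (1 - z j)) (edge_sum _ _ _ _ _) Zn0 pow0 s0 sD0 prodz0.
  by move=> a1 a2 a3 a4 a5 a6 *; field; apply/and5P.
have kE : (Num.sqrt D)^-1 * \prod_j (1 - z j)^-1 * kappa = 1.
  rewrite /kappa prodfV; field.
  by rewrite prodz0 lt0r_neq0// sqrtr_gt0.
have H : Num.sqrt n.+1%:R ^+ k * edge_sum q pref z b n * kappa @[n --> \oo] -->
    (Num.sqrt D)^-1 * \prod_j (1 - z j)^-1 * kappa by exact: cvgMr_tmp.
by rewrite kE in H.
Qed.
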